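(* Let $q\in(0,1)$, $k>0$, and let $\eta\in\mathbb N^{\mathbb Z}$ be a good infinite-volume configuration for ASIP$(q,k)$. Then for every $i\in\mathbb Z$ and $t\ge0$ the first $q$-exponential moment of the current of the ASIP$(q,k)$ on $\mathbb Z$ started from $\eta$ at time $0$ is $$\mathbb E_\eta\big[q^{2J_i(t)}\big]=q^{2(N(\eta)-N_i(\eta))}-\sum_{n=-\infty}^{i-1}q^{4kn}\,\mathbf E_n\Big[q^{-4km(t)}\big(1-q^{-2\eta_{m(t)}}\big)q^{2(N_{m(t)}(\eta)-N_i(\eta))}\Big],$$ where $m(t)$ is the continuous time asymmetric random walk on $\mathbb Z$ jumping left at rate $q^{-2k}[2k]_q$ and right at rate $q^{2k}[2k]_q$, and $\mathbf E_n$ denotes expectation with respect to the law of $m(t)$ started at $n\in\mathbb Z$ at time $0$. Here $N(\eta)-N_i(\eta)=\sum_{n<i}\eta_n$, and the first term on the right-hand side is zero when there are infinitely many particles to the left of $i$ in $\eta$.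
   Context: $\mathbb N=\{0,1,2,\dots\}$; $[a]_q=\frac{q^a-q^{-a}}{q-q^{-1}}$; $(a;q)_m=(1-a)(1-aq)\cdots(1-aq^{m-1})$. ASIP$(q,k)$ on $\mathbb Z$ has generator $\sum_{i\in\mathbb Z}\mathcal L_{i,i+1}$, $$(\mathcal L_{i,i+1}f)(\eta)=q^{\eta_i-\eta_{i+1}+(2k-1)}[\eta_i]_q[2k+\eta_{i+1}]_q\big(f(\eta^{i,i+1})-f(\eta)\big)+q^{\eta_i-\eta_{i+1}-(2k-1)}[2k+\eta_i]_q[\eta_{i+1}]_q\big(f(\eta^{i+1,i})-f(\eta)\big),$$ where $\eta^{i,j}$ is obtained from $\eta$ by moving one particle from $i$ to $j$; from a configuration with finitely many particles it is a well-defined Markov chain. For $\eta\in\mathbb N^{\mathbb Z}$, $\eta^{(L)}$ denotes its restriction to $[-L,L]$ ($\eta^{(L)}_i=\eta_i$ for $|i|\le L$ and $0$ otherwise). For finite configurations, $N_i(\eta)=\sum_{j\ge i}\eta_j$. For general $\eta$, the difference $N_m(\eta)-N_i(\eta)$ means $\sum_{j=m}^{i-1}\eta_j$ if $m\le i$ and $-\sum_{j=i}^{m-1}\eta_j$ if $m>i$. For $\eta,\xi\in\mathbb N^{\mathbb Z}$ finite, put $$D(\eta,\xi)=\prod_{i\in\mathbb Z}\frac{(q^{2(\eta_i-\xi_i+1)};q^2)_{\xi_i}}{(q^{4k};q^2)_{\xi_i}}\,q^{(\xi_i-4ki+2N_{i+1}(\eta))\xi_i}\,\mathbf 1_{\xi_i\le\eta_i}.$$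 $\eta\in\mathbb N^{\mathbb Z}$ is a good infinite-volume configuration for ASIP$(q,k)$ if the limit $\lim_{L\to\infty}\prod_{i\in\mathbb Z}q^{-2\xi_iN_{i+1}(\eta^{(L)})}\,\mathbb E_\xi[D(\eta^{(L)},\xi(t))]$ exists and is finite for all $t\ge0$ and all $\xi\in\mathbb N^{\mathbb Z}$ with $\sum_i\xi_i<\infty$, where $\xi(t)$ is ASIP$(q,k)$ on $\mathbb Z$ started from $\xi$. The current $J_i(t)$ is the net number of particles crossing the bond $(i-1,i)$ from left to right in $[0,t]$, i.e. $J_i(t)=N_i(\eta(t))-N_i(\eta(0))$. The infinite-volume expectation is by convention obtained by the limiting procedure $\mathbb E_\eta[q^{2J_i(t)}]:=\lim_{L\to\infty}\mathbb E_{\eta^{(L)}}\big[q^{2(N_i(\eta(t))-N_i(\eta^{(L)}))}\big]$. *)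

(* Defs.v *)
From HB Require Import structures.
From mathcomp Require Import all_boot all_order all_algebra finmap.
From mathcomp Require Import zify.
From mathcomp Require Import all_classical all_reals all_analysis.

Set Implicit Arguments.
Unset Strict Implicit.
Unset Printing Implicit Defensive.
Import Order.TTheory GRing.Theory Num.Theory.
Import numFieldNormedType.Exports.
Local Open Scope classical_set_scope.
Local Open Scope ring_scope.

(* [X] is, under the family of laws [P x] ("started from [x]"), a time-homogeneous
   continuous-time Markov chain on the discrete space [S] with generator [G].
   The generator is recovered from the transition semigroup acting on bounded
   functions. The past in the Markov property is a finite list [h] of
   observations (time, state) at times in [0, s]. *)
Definition is_markov_chain (R : realType) (S : eqType)
    (G : (S -> R) -> S -> R) (d : measure_display) (Omega : measurableType d)
    (P : S -> probability Omega R) (X : R -> Omega -> S) : Prop :=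
  [/\ forall t y, 0 <= t -> measurable (X t @^-1` [set y]),
      forall x, P x (X 0 @^-1` [set x]) = 1%E,
      forall (x : S) (h : seq (R * S)) (s t : R) (y z : S),
        0 <= s -> 0 <= t -> (forall c, c \in h -> 0 <= c.1 <= s) ->
        let past := [set w | (forall c, c \in h -> X c.1 w = c.2) /\ X s w = y] in
        (P x (past `&` X (s + t)%R @^-1` [set z]) =
         P x past * P y (X t @^-1` [set z]))%E
    & forall (f : S -> R) (x : S),
        (exists M : R, forall y, `|f y| <= M) ->
        h^-1 * (fine 'E_(P x)[fun w => f (X h w)]%E - f x) @[h --> 0^'+]
          --> G f x].

Section Configurations.

Definition config := {fsfun int -> nat with 0%N}.

(* Only used for [i != j]; the value is irrelevant when site [i] is empty, since
   the corresponding jump rate is then zero. *)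
Definition move (eta : config) (i j : int) : config :=
  [fsfun eta with i |-> (eta i).-1, j |-> (eta j).+1].

Definition trunc_config (eta : int -> nat) (L : nat) : config :=
  [fsfun i in [fset (j%:Z - L%:Z)%R | j in iota 0 L.*2.+1]%fset => eta i | 0%N].

Lemma trunc_configE (eta : int -> nat) (L : nat) (i : int) :
  trunc_config eta L i = if `|i| <= L%:Z then eta i else 0%N.
Proof.
rewrite fsfunE; congr (if _ then _ else _).
apply/imfsetP/idP => [[j /= + ->]|iL].
  by rewrite inE mem_iota; move: j => j; lia.
exists (absz (i + L%:Z)); last by lia.
by rewrite /= inE mem_iota; lia.
Qed.

Definition N (i : int) (eta : config) : nat :=
  \big[addn/0%N]_(j \in [set j : int | i <= j]) eta j.

(* N_m(eta) - N_i(eta) for a possibly infinite configuration. *)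
Definition Ndiff (eta : int -> nat) (m i : int) : int :=
  if m <= i then (\big[addn/0%N]_(j \in [set j : int | m <= j < i]) eta j)%:Z
  else - (\big[addn/0%N]_(j \in [set j : int | i <= j < m]) eta j)%:Z.

Definition current (eta0 eta : config) (i : int) : int :=
  (N i eta)%:Z - (N i eta0)%:Z.

End Configurations.

Section ASIP.
Context (R : realType) (q k : R).

Definition qnum (a : R) : R := (q `^ a - q `^ (- a)) / (q - q^-1).

Definition qpoch (a b : R) (m : nat) : R := \prod_(j < m) (1 - a * b ^+ j).

Definition asip_bond (i : int) (f : config -> R) (eta : config) : R :=
  let a : R := (eta i)%:R in
  let b : R := (eta (i + 1))%:R in
  q `^ (a - b + (2 * k - 1)) * qnum a * qnum (2 * k + b)
    * (f (move eta i (i + 1)) - f eta) +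
  q `^ (a - b - (2 * k - 1)) * qnum (2 * k + a) * qnum b
    * (f (move eta (i + 1) i) - f eta).

Definition asip_generator (f : config -> R) (eta : config) : R :=
  \sum_(i \in [set: int]) asip_bond i f eta.

Definition walk_generator (f : int -> R) (n : int) : R :=
  q `^ (- (2 * k)) * qnum (2 * k) * (f (n - 1) - f n) +
  q `^ (2 * k) * qnum (2 * k) * (f (n + 1) - f n).

Definition duality (eta xi : config) : R :=
  \big[*%R/1]_(i \in [set: int])
    (qpoch (q `^ (2 * ((eta i)%:R - (xi i)%:R + 1))) (q ^+ 2) (xi i)
       / qpoch (q `^ (4 * k)) (q ^+ 2) (xi i)
     * q `^ (((xi i)%:R - 4 * k * i%:~R + 2 * (N (i + 1) eta)%:R) * (xi i)%:R)
     * (xi i <= eta i)%N%:R).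

Definition good (d : measure_display) (Omega : measurableType d)
    (P : config -> probability Omega R) (X : R -> Omega -> config)
    (eta : int -> nat) : Prop :=
  forall (t : R) (xi : config), 0 <= t ->
  exists l : R,
    ((\big[*%R/1%R]_(i \in [set: int])
        q `^ (- (2 * (xi i)%:R * (N (i + 1)%R (trunc_config eta L))%:R)))%R%:E
     * 'E_(P xi)[fun w => duality (trunc_config eta L) (X t w)])%E
    @[L --> \oo] --> l%:E.

(* q^{2 (N(eta) - N_i(eta))}, with value 0 if there are infinitely many
   particles to the left of [i]. *)
Definition left_mass_term (eta : int -> nat) (i : int) : R :=
  if (\esum_(n in [set n : int | (n < i)%R]) ((eta n)%:R : R)%:E)%E is s%:E
  then q `^ (2 * s) else 0.

End ASIP.

(* Main.v *)
(** For a finite configuration the heights [q^(2 N_i)] evolve autonomously: the ASIP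
    generator acts on them as the generator of the walk [- m] acts on [i]. Each
    generator is bounded on a closed class of states (fixed particle number, resp. all
    of [int]), so both semigroups are given by their Taylor series in time, and
    comparing coefficients gives
      [E_eta (q^(2 N_i (eta t))) = E_(-i) (q^(2 N_(- m t) (eta)))].
    Telescoping [q^(2 N)] in space and using translation invariance and reversibility
    of [m] with respect to [q^(4 k n)], the moment of the current started from
    [eta^(L)] becomes a boundary term plus the sum over [|x| <= L] of
    [(q^(-2 eta_x) - 1) q^(2 (N_x - N_i)) P_x (m t < i)], whose terms no longer
    depend on [L]; monotone convergence gives the limit. The limit is finite because
    the terms [x < i] telescope, while for [x >= i] one has
    [P_x (m t < i) <= e^(c t) P_x (m t = i - 1)], [c] the total jump rate, and
    the good configuration hypothesis for one dual particle at [i - 1] controls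
    the resulting sum. *)

(* A chain is given here by its transition laws and by right derivatives at time 0 of means of
   bounded functions; no regularity of paths is assumed, so jump times and hitting times are not at
   hand. Hence translation invariance, reversibility and the comparison at [i - 1] are all proved
   first for iterates of an operator. Shifting the generator by the total jump rate, which
   multiplies means by [expR (rate_total * t)], removes its diagonal and leaves [hop], whose
   coefficients are positive: identities become two-term inductions and inequalities between
   iterates pass to the means. Goodness enters because the duality function of one particle at [y]
   is, up to a constant, [q^(-4 k y)] times the height increment at [y]; reversibility absorbs that
   weight. Since [1 - q^(-2 eta_x)] is nonpositive, the series subtracted in the theorem adds
   nonnegative terms, so all sums can be interchanged in the extended reals before finiteness is
   known. *)
Require Import Defs.
From HB Require Import structures.
From mathcomp Require Import all_boot all_order all_algebra finmap.
From mathcomp Require Import zify ring lra.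
From mathcomp Require Import all_classical all_reals all_analysis.
From mathcomp Require Import measurable_realfun.

Set Implicit Arguments.
Unset Strict Implicit.
Unset Printing Implicit Defensive.
Import Order.TTheory GRing.Theory Num.Theory.
Import numFieldNormedType.Exports.
Local Open Scope classical_set_scope.
Local Open Scope ring_scope.

(** * Discrete random variables *)

(** Countable state spaces are handled through codes in [nat]: with a partial decoder, sums over
    states become series, with default 0 at codes of no state. *)
Lemma exists_enumeration (S : Type) (e : S -> nat) : injective e ->
  exists dec : nat -> option S, forall n s, dec n = Some s <-> e s = n.
Proof.
move=> einj; pose dec n := if pselect (exists s, e s = n) is left H
  then Some (projT1 (cid H)) else None.
exists dec => n s; rewrite /dec; case: pselect => [H|nH].
  case: cid => s' /= <-; split=> [[->]//|es]; congr Some; exact: einj.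
by split=> // ens; case: nH; exists s.
Qed.

Section DiscreteVariable.
Context (S : Type) (e : S -> nat) (dec : nat -> option S).
Hypothesis decP : forall n s, dec n = Some s <-> e s = n.
Context (R : realType) (d : measure_display) (T : measurableType d).
Variable Y : T -> S.
Hypothesis mY : forall y, measurable (Y @^-1` [set y]).

Let fiber n : set T := [set w | e (Y w) = n].

Let fiberE n : fiber n = if dec n is Some s then Y @^-1` [set s] else set0.
Proof.
case dn: (dec n) => [s|]; apply/seteqP; split=> w //=.
- by move=> /decP; rewrite dn => -[].
- by rewrite /fiber /= => ->; apply/decP.
- by rewrite /fiber /= => /decP; rewrite dn.
Qed.

Let measurable_fiber n : measurable (fiber n).
Proof. by rewrite fiberE; case: (dec n). Qed.

Let bigcup_fiber : \bigcup_n fiber n = setT.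
Proof. by apply/seteqP; split=> w // _; exists (e (Y w)). Qed.

Let trivIset_fiber : trivIset setT fiber.
Proof. by move=> n m _ _ [w [/= <- <-]]. Qed.

Lemma measurable_discrete (A : set S) : measurable (Y @^-1` A).
Proof.
rewrite (_ : _ @^-1` _ = \bigcup_(n in [set n | if dec n is Some s then A s else False]) fiber n).
  exact: bigcup_measurable.
apply/seteqP; split=> w /=.
  by move=> Aw; exists (e (Y w)) => //=; rewrite (proj2 (decP _ (Y w))).
by move=> [n /= + /decP dn]; rewrite dn.
Qed.

Lemma measurable_fun_discrete d' (U : sigmaRingType d') (f : S -> U) :
  measurable_fun setT (fun w => f (Y w)).
Proof.
by move=> _ B mB; rewrite setTI; exact: (measurable_discrete (f @^-1` B)).
Qed.

Local Open Scope ereal_scope.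

Lemma measure_discrete (mu : {measure set T -> \bar R}) (B : set T) :
  measurable B ->
  mu B = \sum_(n <oo) oapp (fun s => mu (Y @^-1` [set s] `&` B)) 0 (dec n).
Proof.
move=> mB; rewrite -[B in LHS]setTI -bigcup_fiber setI_bigcupl measure_bigcup//; first last.
- by apply: trivIset_setIr; exact: trivIset_fiber.
- by move=> n _; exact: measurableI.
rewrite (eq_eseriesl _ (Q := xpredT)); last by move=> n; rewrite mem_set.
by apply: eq_eseriesr => n _; rewrite fiberE; case: (dec n) => //=; rewrite set0I measure0.
Qed.

Lemma ge0_integral_discrete (mu : {measure set T -> \bar R}) (f : S -> \bar R) :
  (forall s, 0 <= f s) ->
  \int[mu]_w f (Y w) =
  \sum_(n <oo) oapp (fun s => f s * mu (Y @^-1` [set s])) 0 (dec n).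
Proof.
move=> f0; rewrite -{1}bigcup_fiber ge0_integral_bigcup//; last first.
  by rewrite bigcup_fiber; exact: measurable_fun_discrete.
apply: eq_eseriesr => n _; rewrite fiberE; case: (dec n) => [s|]/=; last first.
  by rewrite integral_set0.
rewrite -integral_cst//; apply: eq_integral => w.
by rewrite inE /= => ->.
Qed.

End DiscreteVariable.

(** * Markov semigroups on countable spaces *)

Section MarkovSemigroup.
Context (S : eqType) (e : S -> nat) (e_inj : injective e).
Context (R : realType) (G : (S -> R) -> S -> R).
Context (d : measure_display) (Omega : measurableType d).
Context (P : S -> probability Omega R) (X : R -> Omega -> S).
Hypothesis hX : is_markov_chain G P X.

Lemma markov_measurable t y : 0 <= t -> measurable (X t @^-1` [set y]).
Proof. by case: hX => mX _ _ _; exact: mX. Qed.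

Lemma markov_two_times x s t y z : 0 <= s -> 0 <= t ->
  (P x (X s @^-1` [set y] `&` X (s + t) @^-1` [set z]) =
   P x (X s @^-1` [set y]) * P y (X t @^-1` [set z]))%E.
Proof.
move=> s0 t0; case: hX => _ _ /(_ x [::] s t y z s0 t0) + _.
have -> : [set w | (forall c : R * S, c \in [::] -> X c.1 w = c.2) /\ X s w = y]
    = X s @^-1` [set y].
  by apply/seteqP; split=> w /=; [case|move=> ->].
by apply.
Qed.

(** Both sides expand into one double series over the states at times [s] and [s + t]; nonnegativity
    of [f] permits the interchange. *)
Lemma chapman_kolmogorov (f : S -> R) x s t : 0 <= s -> 0 <= t ->
  (forall y, 0 <= f y) ->
  (\int[P x]_w (f (X (s + t) w))%:E =
   \int[P x]_w \int[P (X s w)]_w' (f (X t w'))%:E)%E.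
Proof.
move=> s0 t0 f0; have [dec decP] := exists_enumeration e_inj.
have st0 : 0 <= s + t by exact: addr_ge0.
have mXs y := markov_measurable y s0.
have mXt y := markov_measurable y t0.
have mXst y := markov_measurable y st0.
rewrite (ge0_integral_discrete decP mXst (P x) (f := EFin \o f)); last by move=> ?; rewrite lee_fin.
rewrite (ge0_integral_discrete decP mXs (P x)
  (f := fun y => \int[P y]_w (f (X t w))%:E)%E); last first.
  by move=> y; apply: integral_ge0 => w _; rewrite lee_fin.
pose a (n m : nat) : \bar R := (oapp (fun y =>
   oapp (fun z => (f z)%:E * P x (X s @^-1` [set y] `&` X (s + t)%R @^-1` [set z])) 0 (dec m))
   0 (dec n))%E.
have a0 n m : (0 <= a n m)%E.
  by rewrite /a; case: (dec n) => //= y; case: (dec m) => //= z; rewrite mule_ge0// lee_fin.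
transitivity (\sum_(n <oo) \sum_(m <oo) a n m)%E; last first.
  apply: eq_eseriesr => n _; rewrite /a; case: (dec n) => [y|]/=; last first.
    by rewrite eseries0.
  rewrite (ge0_integral_discrete decP mXt (P y) (f := EFin \o f)); last first.
    by move=> ?; rewrite lee_fin.
  rewrite -(fineK (fin_num_measure (P x) _ (mXs y))) muleC -nneseriesZl; last first.
    by move=> m _; case: (dec m) => //= z; rewrite mule_ge0// lee_fin.
  apply: eq_eseriesr => m _; case: (dec m) => [z|]/=; last by rewrite mule0.
  by rewrite fineK ?fin_num_measure// markov_two_times// muleCA.
rewrite nneseries_interchange//; apply: eq_eseriesr => m _.
rewrite /a; case: (dec m) => [z|]/=; last first.
  by rewrite eseries0// => n _ _; case: (dec n).
rewrite [P x _](measure_discrete decP mXs)//.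
rewrite -nneseriesZl; last by move=> n _; case: (dec n).
by apply: eq_eseriesr => n _; case: (dec n) => //=; rewrite mule0.
Qed.

Definition markov_mean (f : S -> R) t x : R := fine ('E_(P x)[fun w => f (X t w)])%E.

(** Off the event of being at [y], a set of probability [1 - p] contributes between 0 and
    [M * (1 - p)]. The case [p = 1] gives the value at time 0, and [p] close to 1 gives continuity
    in time. *)
Lemma markov_mean_law (f : S -> R) (M : R) t x y : 0 <= t ->
  (forall y, 0 <= f y <= M) ->
  let p := fine (P x (X t @^-1` [set y])) in
  ('E_(P x)[fun w => f (X t w)] = (markov_mean f t x)%:E)%E /\
  f y * p <= markov_mean f t x <= f y * p + M * (1 - p).
Proof.
move=> t0 fM p; have [dec decP] := exists_enumeration e_inj.
have mX z := markov_measurable z t0.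
pose B := X t @^-1` [set y]; have mB : measurable B := mX y.
have PB : (P x B = p%:E)%E by rewrite fineK// fin_num_measure.
have PCB : (P x (~` B) = (1 - p)%:E)%E.
  by rewrite probability_setC ?PB /B; [rewrite EFinB|exact: mX].
have f0 w : (0 <= (f (X t w))%:E)%E by rewrite lee_fin; case/andP: (fM (X t w)).
have mf : measurable_fun setT (EFin \o (fun w => f (X t w))).
  apply/measurable_EFinP; exact: (measurable_fun_discrete decP mX).
have EB : ('E_(P x)[fun w => f (X t w)] =
   (f y * p)%:E + \int[P x]_(w in ~` B) (f (X t w))%:E)%E.
  rewrite unlock -(setUv B) ge0_integral_setU//=; first last.
  - by rewrite disj_set2E setICr.
  - by rewrite setUv.
  - exact: measurableC.
  congr (_ + _)%E.
  transitivity (\int[P x]_(w in B) (f y)%:E)%E.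
    by apply: eq_integral => w; rewrite inE /B /= => ->.
  by rewrite integral_cst//= -/B EFinM -PB.
have CB_ge0 : (0 <= \int[P x]_(w in ~` B) (f (X t w))%:E)%E by exact: integral_ge0.
have CB_le : (\int[P x]_(w in ~` B) (f (X t w))%:E <= (M * (1 - p))%:E)%E.
  rewrite EFinM -PCB -integral_cst; last exact: measurableC.
  apply: ge0_le_integral => //.
  - exact: measurableC.
  - exact: measurable_funS mf.
  - by move=> w _; rewrite lee_fin; case/andP: (fM (X t w)).
have fin : ('E_(P x)[fun w => f (X t w)] \is a fin_num)%E.
  rewrite EB fin_numD/= ge0_fin_numE//; exact: le_lt_trans CB_le (ltry _).
split; first by rewrite /markov_mean fineK.
rewrite -!lee_fin /markov_mean fineK// EB; apply/andP; split.
  by rewrite leeDl.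
by rewrite EFinD leeD2l.
Qed.

Section Bounded.
Variables (f : S -> R) (M : R).
Hypothesis fM : forall y, 0 <= f y <= M.

Lemma markov_meanE t x : 0 <= t ->
  ('E_(P x)[fun w => f (X t w)] = (markov_mean f t x)%:E)%E.
Proof. by move=> t0; case: (markov_mean_law x x t0 fM). Qed.

Lemma markov_mean_bounds t x : 0 <= t -> 0 <= markov_mean f t x <= M.
Proof.
move=> t0; have mX := markov_measurable x t0.
have [_ /andP[]] := markov_mean_law x x t0 fM; set p := fine _ => lo hi.
have /andP[f0 fM'] := fM x.
have p0 : 0 <= p by exact: fine_ge0.
have p1 : p <= 1 by rewrite -lee_fin fineK ?fin_num_measure// probability_le1.
apply/andP; split; first by apply: le_trans lo; rewrite mulr_ge0.
by apply: le_trans hi _; nra.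
Qed.

Lemma markov_mean0 x : markov_mean f 0 x = f x.
Proof.
have [_] := markov_mean_law x x (lexx 0) fM.
have [_ -> _ _] := hX; rewrite /= subrr mulr0 addr0 !mulr1 => H.
by apply/eqP; rewrite eq_le andbC.
Qed.

Lemma markov_meanD s t x : 0 <= s -> 0 <= t ->
  markov_mean f (s + t) x = markov_mean (markov_mean f t) s x.
Proof.
move=> s0 t0; congr fine; rewrite unlock chapman_kolmogorov//; last first.
  by move=> y; case/andP: (fM y).
by apply: eq_integral => w _; rewrite -markov_meanE// unlock.
Qed.

(** The mean at [h + t] is the mean at time [h] of [markov_mean f t], from which the event of being
    at [x] is split off. The bound does not involve [t], which is what yields continuity from the
    left. *)
Lemma markov_mean_increment t h x : 0 <= t -> 0 <= h ->
  `|markov_mean f (h + t) x - markov_mean f t x|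
  <= M * (1 - fine (P x (X h @^-1` [set x]))).
Proof.
move=> t0 h0; rewrite markov_meanD//.
have bt y := markov_mean_bounds y t0.
have [_] := markov_mean_law x x h0 bt.
have /andP[] := bt x; set p := fine _; set m1 := markov_mean f t x.
set m2 := markov_mean _ _ _ => m0 mM.
have mXh := markov_measurable x h0.
have p1 : p <= 1 by rewrite -lee_fin fineK ?fin_num_measure// probability_le1.
by move=> /andP[lo hi]; rewrite ler_norml; nra.
Qed.

(** Kolmogorov's backward equation: [h] is made the first time step, so the generator acts on
    [markov_mean f t], which is again bounded. *)
Lemma markov_mean_right_derivative t x : 0 <= t ->
  h^-1 * (markov_mean f (t + h) x - markov_mean f t x) @[h --> 0^'+]
    --> G (markov_mean f t) x.
Proof.
move=> t0; case: hX => _ _ _ /(_ (markov_mean f t) x) H.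
have {}/H H : exists M, forall y, `|markov_mean f t y| <= M.
  by exists M => y; have /andP[? ?] := markov_mean_bounds y t0; rewrite ger0_norm.
apply: cvg_trans H; apply: near_eq_cvg; near=> h; have h0 : 0 <= h by near: h; exact: nbhs_right_ge.
by rewrite [t + h]addrC markov_meanD.
Unshelve. all: by end_near. Qed.

End Bounded.

Lemma markov_mean_indicator (a : S -> bool) t x : 0 <= t ->
  (P x (X t @^-1` [set y | a y]) = (markov_mean (fun y => (a y)%:R) t x)%:E)%E.
Proof.
move=> t0; have [dec decP] := exists_enumeration e_inj.
have ma : measurable (X t @^-1` [set y | a y]).
  by apply: (measurable_discrete decP) => y; exact: markov_measurable.
rewrite -(@markov_meanE _ 1)//; last by move=> y; case: (a y); rewrite ?lexx ?ler01.
rewrite -(@expectation_indic _ _ _ (P x) _ ma); congr expectation.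
apply/funext => w; rewrite indicE; congr (_%:R).
by apply: (congr1 nat_of_bool); apply/idP/idP; rewrite inE.
Qed.

(** The difference quotient of the mean of the indicator of [x] has a finite limit, so its product
    with [h] tends to 0. *)
Lemma holding_probability_cvg1 x :
  fine (P x (X h @^-1` [set x])) @[h --> 0^'+] --> (1 : R).
Proof.
pose f y : R := (y == x)%:R.
have fM y : 0 <= f y <= 1 by rewrite /f; case: eqP; rewrite ?lexx ?ler01.
have H := markov_mean_right_derivative fM (x := x) (lexx 0).
have id0 : (h : R) @[h --> 0^'+] --> (0 : R).
  by apply: cvg_at_right_filter; exact: cvg_id.
have : h * (h^-1 * (markov_mean f (0 + h) x - markov_mean f 0 x)) + 1
    @[h --> 0^'+] --> 0 * G (markov_mean f 0) x + 1.
  by apply: cvgD; [exact: cvgM|exact: cvg_cst].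
rewrite mul0r add0r; apply: cvg_trans; apply: near_eq_cvg; near=> h.
have h0 : 0 < h by near: h; exact: nbhs_right_gt.
rewrite /= (markov_mean0 fM) add0r mulrA divff ?gt_eqF// mul1r /f eqxx subrK.
rewrite -[LHS]/(fine (_%:E)) -(markov_mean_indicator (pred1 x)) ?ltW//.
by congr (fine (P x _)); apply/seteqP; split=> w /=; move/eqP.
Unshelve. all: by end_near. Qed.

Lemma markov_mean_left_continuous (f : S -> R) (M : R) t x :
  (forall y, 0 <= f y <= M) -> 0 < t ->
  markov_mean f r x @[r --> t^'-] --> markov_mean f t x.
Proof.
move=> fM t0; have M0 : 0 <= M by case/andP: (fM x); exact: le_trans.
apply/cvgrPdist_le => eps eps0.
(* The denominator is [M + 1] because [M] may be zero. *)
have /cvgrPdist_le/(_ (eps / (M + 1))) := holding_probability_cvg1 x.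
have eM : 0 < eps / (M + 1) by rewrite divr_gt0// ltr_wpDl.
move=> /(_ eM) [del /= del0 Hdel].
near=> r; have rt : r < t by near: r; exact: nbhs_left_lt.
have r0 : 0 <= r by apply: ltW; near: r; exact: nbhs_left_gt.
have rdel : t - del < r by near: r; apply: nbhs_left_gt; rewrite ltrBlDr ltrDl.
have tr0 : 0 < t - r by rewrite subr_gt0.
have := markov_mean_increment fM x r0 (ltW tr0); rewrite subrK => /le_trans; apply.
have := Hdel (t - r); rewrite /ball_/= sub0r normrN gtr0_norm// => /(_ _ tr0).
have -> : t - r < del by lra.
move=> /(_ isT) /(le_trans (ler_norm _)) p_le.
rewrite (le_trans (ler_wpM2l M0 p_le))// mulrCA ler_piMr ?(ltW eps0)//.
by rewrite ler_pdivrMr ?mul1r ?lerDl// ltr_wpDl.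
Unshelve. all: by end_near. Qed.

End MarkovSemigroup.

(** * Taylor expansion of a bounded semigroup *)

Section RightDerivative.
Context (R : realType).

(* A Markov chain given by its transition laws only provides right derivatives in
   time, hence this form of the mean value inequality. *)
Lemma le0_right_derivative (f D : R -> R) (T : R) : 0 <= T ->
  (forall t, 0 < t <= T -> f r @[r --> t^'-] --> f t) ->
  (forall t, 0 <= t < T -> h^-1 * (f (t + h) - f t) @[h --> 0^'+] --> D t) ->
  (forall t, 0 <= t < T -> D t <= 0) ->
  f T <= f 0.
Proof.
move=> T0 fleft fD D0.
(* The slope [eps] leaves room to move past a time at which the derivative is merely nonpositive. *)
suff : forall eps, 0 < eps -> f T <= f 0 + eps * T.
  move=> H; apply/ler_addgt0Pr => eps eps0.
  have T1 : 0 < T + 1 by rewrite ltr_wpDl.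
  apply: (le_trans (H (eps / (T + 1)) _)); first by rewrite divr_gt0.
  rewrite lerD2l mulrAC -mulrA ler_piMr ?ltW//.
  by rewrite ltr_pdivrMr// mul1r ltrDl.
move=> eps eps0.
(* Left continuity puts the supremum of these times in [A], and the right derivative carries [A]
   beyond any point short of [T]. *)
pose A := [set s | 0 <= s <= T /\ forall r, 0 <= r <= s -> f r <= f 0 + eps * r].
have A0 : A 0.
  split=> [|r]; first by rewrite lexx.
  by move=> /andP[r0 r0']; rewrite (@le_anti _ _ r 0) ?r0 ?r0'// mulr0 addr0.
have hA : has_sup A by split; [exists 0|exists T => s [/andP[]]].
pose s := sup A.
have s0 : 0 <= s by apply: ub_le_sup => //; case: hA.
have sT : s <= T by apply: ge_sup; [exists 0|move=> r [/andP[]]].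
have below r : 0 <= r < s -> f r <= f 0 + eps * r.
  move=> /andP[r0 rs].
  have [u [Au1 Au2] ru] := sup_adherent (eps := s - r) ltac:(by rewrite subr_gt0) hA.
  apply: Au2; rewrite r0 /=; move: ru; rewrite -/s; lra.
have As : A s.
  split=> [|r /andP[r0]]; first by rewrite s0.
  rewrite le_eqVlt => /orP[/eqP ->|rs]; last by apply: below; rewrite r0.
  move: s0; rewrite le_eqVlt => /orP[/eqP <-|s0]; first by rewrite mulr0 addr0.
  have sl : f 0 + eps * r @[r --> s^'-] --> f 0 + eps * s.
    apply: cvgD; first exact: cvg_cst.
    apply: cvgMr; apply: cvg_at_left_filter; exact: cvg_id.
  have fl : f r @[r --> s^'-] --> f s by apply: fleft; rewrite s0.
  apply: (ler_cvg_to fl sl).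
  near=> u; apply: below; apply/andP; split; last by near: u; exact: nbhs_left_lt.
  by apply: ltW; near: u; exact: nbhs_left_gt.
move: sT; rewrite le_eqVlt => /orP[/eqP <-|sT]; first by apply: As.2; rewrite s0 lexx.
have sT' : 0 <= s < T by rewrite s0.
have /cvgrPdist_lt/(_ _ eps0) := fD _ sT'.
move=> [del /= del0 Hdel]; pose u := Num.min (del / 2) (T - s).
have u0 : 0 < u by rewrite lt_min divr_gt0//= subr_gt0.
have udel : u < del by rewrite gt_min ltr_pdivrMr// ltr_pMr// ltrDl ltr01.
have suT : s + u <= T by rewrite -lerBrDl ge_min lexx orbT.
suff : A (s + u).
  move=> Asu; have : s + u <= s by apply: ub_le_sup => //; case: hA.
  by rewrite gerDl leNgt u0.
split=> [|r /andP[r0 rsu]]; first by rewrite addr_ge0 ?(ltW u0).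
have [rs|sr] := leP r s; first by apply: As.2; rewrite r0.
pose h := r - s; have h0 : 0 < h by rewrite subr_gt0.
have hu : h <= u by rewrite lerBlDl.
have := Hdel h; rewrite /ball_/= sub0r normrN gtr0_norm// => /(_ (le_lt_trans hu udel) h0).
have -> : s + h = r by rewrite /h addrC subrK.
rewrite distrC => /(le_lt_trans (ler_norm _)) H.
have : f r - f s <= eps * h.
  have : h^-1 * (f r - f s) <= eps by have := D0 _ sT'; lra.
  by rewrite mulrC ler_pdivrMr.
have : f s <= f 0 + eps * s by apply: As.2; rewrite s0 lexx.
by rewrite /h; lra.
Unshelve. all: by end_near. Qed.

End RightDerivative.

Section TaylorExpansion.
Context (R : realType).

Lemma right_derivative_poly (p : {poly R}) t :
  h^-1 * (p.[t + h] - p.[t]) @[h --> 0^'+] --> p^`().[t].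
Proof.
have [+ <-] := is_derive_poly p t; rewrite /derivable /= => dp.
apply: cvg_trans (cvg_dnbhs_at_right dp).
by apply: near_eq_cvg; near=> h; rewrite /= /GRing.scale/= mulr1 [t + h]addrC.
Unshelve. all: by end_near. Qed.

Definition taylor_poly (a : nat -> R) (J : nat) : {poly R} :=
  \poly_(j < J) (a j / j`!%:R).

Lemma deriv_taylor_poly a J :
  (taylor_poly a J.+1)^`() = taylor_poly (fun j => a j.+1) J.
Proof.
apply/polyP => j; rewrite coef_deriv !coef_poly ltnS; case: ltnP => // _.
  by rewrite factS natrM -[LHS]mulr_natr [_%:R * _]mulrC invfM mulrA mulfVK// pnatr_eq0.
by rewrite mul0rn.
Qed.

Lemma taylor_poly0 a J : (taylor_poly a J.+1).[0] = a 0%N.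
Proof. by rewrite horner_coef0 coef_poly /= fact0 divr1. Qed.

Context (S : Type) (W : (S -> R) -> S -> R) (Z : set S) (C : R).
Hypothesis Wlin : forall (a : R) u v x,
  W (fun y => a * u y + v y) x = a * W u x + W v x.
(** Besides boundedness this encodes that [Z] is closed: by linearity, [W u] on [Z] depends only on
    [u] on [Z]. *)
Hypothesis WC : forall u (M : R), (forall y, Z y -> `|u y| <= M) ->
  forall x, Z x -> `|W u x| <= C * M.

Lemma W_taylor_poly (u : S -> R) J t x :
  W (fun y => (taylor_poly (fun j => iter j W u y) J).[t]) x =
  (taylor_poly (fun j => iter j.+1 W u x) J).[t].
Proof.
rewrite horner_poly; under [X in W X]eq_fun do rewrite horner_poly.
have W0 : W (fun=> 0) x = 0.
  rewrite (_ : (fun=> 0) = fun y => (-1) * u y + u y); first by rewrite Wlin; ring.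
  by apply/funext => y; ring.
elim: J => [|J IH].
  by rewrite big_ord0; under [X in W X]eq_fun do rewrite big_ord0.
rewrite big_ord_recr /= -IH addrC mulrAC -mulrA.
under [X in W X]eq_fun do rewrite big_ord_recr /= addrC mulrAC -mulrA mulrC.
rewrite Wlin mulrC; congr (_ * _ + _).
Qed.

Variable z : R -> S -> R.
Hypothesis z_left : forall (t : R) x, 0 < t -> Z x ->
  z r x @[r --> t^'-] --> z t x.
Hypothesis z_right : forall (t : R) x, 0 <= t -> Z x ->
  h^-1 * (z (t + h) x - z t x) @[h --> 0^'+] --> W (z t) x.

(** Induction on [J]: the right derivative of the remainder of order [J + 1] is [W] applied to the
    remainder of order [J], hence at most [C] times the previous bound, which is exactly the
    derivative of the new bound [K]. The one-sided mean value inequality is applied to the remainder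
    and to its opposite. *)
Lemma taylor_remainder (M T : R) J (t : R) x :
  (forall (t : R) y, 0 <= t <= T -> Z y -> `|z t y| <= M) ->
  0 <= t <= T -> Z x ->
  `|z t x - (taylor_poly (fun j => iter j W (z 0) x) J).[t]|
    <= M * (C ^+ J * t ^+ J / J`!%:R).
Proof.
move=> zM; elim: J t x => [|J IH] t x /andP[t0 tT] Zx.
  by rewrite /taylor_poly poly_def big_ord0 horner0 subr0 fact0 divr1 !expr0 !mulr1 zM// t0.
pose a j := iter j W (z 0) x; pose p := taylor_poly a J.+1.
pose K : {poly R} := (M * (C ^+ J.+1) / J.+1`!%:R) *: 'X^(J.+1).
have KE s : K.[s] = M * (C ^+ J.+1 * s ^+ J.+1 / J.+1`!%:R).
  by rewrite /K hornerZ hornerXn; ring.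
have K'E s : K^`().[s] = C * (M * (C ^+ J * s ^+ J / J`!%:R)).
  have j1 : J.+1%:R != 0 :> R by rewrite pnatr_eq0.
  have j2 : J`!%:R != 0 :> R by rewrite pnatr_eq0 -lt0n fact_gt0.
  rewrite /K derivZ derivXn hornerZ hornerMn hornerXn/= factS natrM exprS.
  rewrite -[s ^+ J *+ _]mulr_natr; move: j1 j2; move: (J.+1%:R : R) (J`!%:R : R) => u v u0 v0.
  by field; rewrite ?u0 ?v0.
have cont_at_left (q : {poly R}) s : q.[r] @[r --> s^'-] --> q.[s].
  by apply: cvg_at_left_filter; exact: continuous_horner.
pose D s := W (z s) x - p^`().[s].
have DE s : 0 <= s <= T -> `|D s| <= K^`().[s].
  move=> sT; rewrite /D /p deriv_taylor_poly K'E.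
  have -> : W (z s) x - (taylor_poly (fun j => a j.+1) J).[s] =
     W (fun y => (-1) * (taylor_poly (fun j => iter j W (z 0) y) J).[s] + z s y) x.
    by rewrite Wlin W_taylor_poly mulN1r addrC.
  by apply: WC => // y Zy; rewrite mulN1r addrC; exact: IH.
have p0 : p.[0] = z 0 x by rewrite /p taylor_poly0.
have K0 : K.[0] = 0 by rewrite KE expr0n/=; ring.
have Hleft s : 0 < s <= t -> z r x - p.[r] @[r --> s^'-] --> z s x - p.[s].
  by move=> /andP[s0 _]; apply: cvgB; [exact: z_left|exact: cont_at_left].
have Hright s : 0 <= s < t ->
    h^-1 * ((z (s + h) x - p.[s + h]) - (z s x - p.[s])) @[h --> 0^'+] --> D s.
  move=> /andP[s0 _]; rewrite (_ : (fun h => _) = (fun h =>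
    h^-1 * (z (s + h) x - z s x) - h^-1 * (p.[s + h] - p.[s]))); last first.
    by apply/funext => h; ring.
  by apply: cvgB; [exact: z_right|exact: right_derivative_poly].
have sT s : 0 <= s < t -> 0 <= s <= T.
  by move=> /andP[-> /ltW st]; exact: le_trans tT.
rewrite -KE -/a -/p ler_norml; apply/andP; split; last first.
- have /= := @le0_right_derivative R (fun s => (z s x - p.[s]) - K.[s])
    (fun s => D s - K^`().[s]) t t0.
  rewrite p0 K0 subrr subr0 subr_le0; apply.
  + by move=> s st; apply: cvgB; [exact: Hleft|exact: cont_at_left].
  + move=> s st; rewrite (_ : (fun h => _) = (fun h =>
      h^-1 * ((z (s + h) x - p.[s + h]) - (z s x - p.[s])) - h^-1 * (K.[s + h] - K.[s]))).
      by apply: cvgB; [exact: Hright|exact: right_derivative_poly].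
    by apply/funext => h; ring.
  + by move=> s /sT/DE; rewrite subr_le0; exact: le_trans (ler_norm _).
- have /= := @le0_right_derivative R (fun s => - (z s x - p.[s]) - K.[s])
    (fun s => - D s - K^`().[s]) t t0.
  rewrite p0 K0 subrr subr0 oppr0 subr_le0 lerNl; apply.
  + by move=> s st; apply: cvgB; [apply: cvgN; exact: Hleft|exact: cont_at_left].
  + move=> s st; rewrite (_ : (fun h => _) = (fun h =>
      - (h^-1 * ((z (s + h) x - p.[s + h]) - (z s x - p.[s]))) - h^-1 * (K.[s + h] - K.[s]))).
      by apply: cvgB; [apply: cvgN; exact: Hright|exact: right_derivative_poly].
    by apply/funext => h; ring.
  + by move=> s /sT/DE; rewrite subr_le0 -normrN; exact: le_trans (ler_norm _).
Qed.


End TaylorExpansion.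

(** * Exponential series for the means of a Markov chain *)

Section MarkovSeries.
Context (S : eqType) (e : S -> nat) (e_inj : injective e).
Context (R : realType) (G : (S -> R) -> S -> R).
Context (d : measure_display) (Omega : measurableType d).
Context (P : S -> probability Omega R) (X : R -> Omega -> S).
Hypothesis hX : is_markov_chain G P X.
Context (Z : set S) (C : R).
Hypothesis Glin : forall (a : R) u v x,
  G (fun y => a * u y + v y) x = a * G u x + G v x.
Hypothesis GC : forall u (M : R), (forall y, Z y -> `|u y| <= M) ->
  forall x, Z x -> `|G u x| <= C * M.

(** Generator of the semigroup multiplied by [expR (c * t)]; for the walk, taking [c] to be the
    total jump rate cancels the diagonal. *)
Definition shifted (c : R) (u : S -> R) x : R := G u x + c * u x.

Lemma right_derivative_expR (c t : R) :
  h^-1 * (expR (c * (t + h)) - expR (c * t)) @[h --> 0^'+] --> c * expR (c * t).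
Proof.
have [+ ] : is_derive t 1 (fun s => expR (c * s)) (c * expR (c * t)).
  apply: is_derive_eq; rewrite /GRing.scale/= !mulr1; ring.
rewrite /derivable /= => + <- => dp.
apply: cvg_trans (cvg_dnbhs_at_right dp).
by apply: near_eq_cvg; near=> h; rewrite /= /GRing.scale/= mulr1 [t + h]addrC.
Unshelve. all: by end_near. Qed.

(** The mean multiplied by [expR (c * t)] solves the equation of [shifted c], and its Taylor
    remainder is bounded by a multiple of the general term of an exponential series. *)
Lemma markov_mean_series (c : R) (f : S -> R) (M t : R) x :
  0 <= c -> (forall y, 0 <= f y <= M) -> 0 <= t -> Z x ->
  (taylor_poly (fun j => iter j (shifted c) f x) J).[t] @[J --> \oo]
    --> expR (c * t) * markov_mean P X f t x.
Proof.
move=> c0 fM t0 Zx.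
pose z s y := expR (c * s) * markov_mean P X f s y.
have mm_right s y : 0 <= s -> markov_mean P X f (s + h) y @[h --> 0^'+] -->
    markov_mean P X f s y.
  move=> s0; have id0 : (h : R) @[h --> 0^'+] --> (0 : R).
    by apply: cvg_at_right_filter; exact: cvg_id.
  have : h * (h^-1 * (markov_mean P X f (s + h) y - markov_mean P X f s y))
      + markov_mean P X f s y
    @[h --> 0^'+] --> 0 * G (markov_mean P X f s) y + markov_mean P X f s y.
    apply: cvgD; last exact: cvg_cst.
    by apply: cvgM => //; exact: (markov_mean_right_derivative e_inj hX fM).
  rewrite mul0r add0r; apply: cvg_trans; apply: near_eq_cvg; near=> h.
  have h0 : 0 < h by near: h; exact: nbhs_right_gt.
  by rewrite /= mulrA divff ?gt_eqF// mul1r subrK.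
have z_left (s : R) y : 0 < s -> Z y -> z r y @[r --> s^'-] --> z s y.
  move=> s0 _; apply: cvgM; last exact: (markov_mean_left_continuous e_inj hX fM).
  apply: cvg_at_left_filter; apply: continuous_comp; last exact: continuous_expR.
  by apply: cvgMr; exact: cvg_id.
have z_right (s : R) y : 0 <= s -> Z y ->
    h^-1 * (z (s + h) y - z s y) @[h --> 0^'+] --> shifted c (z s) y.
  move=> s0 _; rewrite (_ : shifted c (z s) y =
    expR (c * s) * G (markov_mean P X f s) y +
    (c * expR (c * s)) * markov_mean P X f s y); last first.
    rewrite /shifted /z mulrA; congr (_ + _).
    have := Glin (expR (c * s)) (markov_mean P X f s) (fun=> 0) y.
    have := Glin (-1) (fun=> 0) (fun=> 0) y.
    rewrite (_ : (fun=> -1 * 0 + 0) = fun=> 0) ?mulN1r ?addNr; last by apply/funext => ?; ring.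
    by move=> ->; rewrite addr0 => <-; congr (G _ y); apply/funext => ?; rewrite addr0.
  (* Product rule; its second term has the mean at [s + h], hence the need for [mm_right]. *)
  rewrite (_ : (fun h => _) = (fun h =>
     expR (c * s) * (h^-1 * (markov_mean P X f (s + h) y - markov_mean P X f s y)) +
     (h^-1 * (expR (c * (s + h)) - expR (c * s))) * markov_mean P X f (s + h) y)).
    apply: cvgD.
      by apply: cvgMr; exact: (markov_mean_right_derivative e_inj hX fM).
    by apply: cvgM; [exact: right_derivative_expR|exact: mm_right].
  by apply/funext => h; rewrite /z; ring.
have Slin (a : R) u v y : shifted c (fun y => a * u y + v y) y =
    a * shifted c u y + shifted c v y.
  by rewrite /shifted Glin; ring.
have SC u (N : R) : (forall y, Z y -> `|u y| <= N) ->
    forall y, Z y -> `|shifted c u y| <= (C + c) * N.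
  move=> uN y Zy; rewrite /shifted (le_trans (ler_normD _ _))// mulrDl lerD//.
    exact: GC.
  by rewrite normrM ger0_norm// ler_wpM2l// uN.
have M0 : 0 <= M by case/andP: (fM x); exact: le_trans.
have zM (s : R) y : 0 <= s <= t -> Z y -> `|z s y| <= expR (c * t) * M.
  move=> /andP[s0 st] _; have /andP[m0 mM] := markov_mean_bounds e_inj hX fM y s0.
  rewrite /z normrM (ger0_norm m0) ger0_norm ?expR_ge0//.
  by apply: ler_pM => //; rewrite ?expR_ge0// ler_expR ler_wpM2l.
have z0 : z 0 = f.
  by apply/funext => y; rewrite /z mulr0 expR0 mul1r (markov_mean0 e_inj hX fM).
have rem J : `|z t x - (taylor_poly (fun j => iter j (shifted c) f x) J).[t]| <=
    expR (c * t) * M * exp_coeff ((C + c) * t) J.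
  have tt : 0 <= t <= t by rewrite t0 lexx.
  have := taylor_remainder Slin SC z_left z_right J zM tt Zx.
  by rewrite z0 /exp_coeff /= exprMn .
have cv0 : expR (c * t) * M * exp_coeff ((C + c) * t) J @[J --> \oo] --> (0 : R).
  rewrite -[X in _ --> X](mulr0 (expR (c * t) * M)); apply: cvgMr.
  exact: cvg_series_cvg_0 (is_cvg_series_exp_coeff _).
apply/cvgrPdist_le => eps eps0.
move/cvgrPdist_le/(_ _ eps0): cv0; apply: filterS => J.
rewrite sub0r normrN; apply: le_trans; apply: le_trans (rem J) (ler_norm _).
Unshelve. all: by end_near. Qed.

End MarkovSeries.

(** * The asymmetric random walk *)

Lemma pickle_int_inj : injective (choice.pickle : int -> nat).
Proof. exact: (pcan_inj choice.pickleK). Qed.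

Section Walk.
Context (R : realType) (q k : R).
Hypotheses (hq0 : 0 < q) (hq1 : q < 1) (hk : 0 < k).

Lemma powRDq x y : q `^ (x + y) = q `^ x * q `^ y.
Proof. by rewrite powRD// (gt_eqF hq0) implybT. Qed.

Definition rate_left : R := q `^ (- (2 * k)) * qnum q (2 * k).
Definition rate_right : R := q `^ (2 * k) * qnum q (2 * k).

Lemma qnum_gt0 a : 0 < a -> 0 < qnum q a.
Proof.
move=> a0; have lt_inv (x : R) : 0 < x -> x < 1 -> x - x^-1 < 0.
  by move=> x0 x1; rewrite subr_lt0; apply: (lt_trans x1); rewrite invf_gt1.
have qa1 : q `^ a < 1.
  by rewrite /powR gt_eqF// expR_lt1 pmulr_rlt0// ln_lt0// hq0.
by rewrite /qnum powRN nmulr_rgt0 ?invr_lt0 lt_inv// powR_gt0.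
Qed.

Lemma rate_left_gt0 : 0 < rate_left.
Proof. by rewrite mulr_gt0 ?powR_gt0// qnum_gt0// mulr_gt0. Qed.

Lemma rate_right_gt0 : 0 < rate_right.
Proof. by rewrite mulr_gt0 ?powR_gt0// qnum_gt0// mulr_gt0. Qed.

(** Detailed balance for the weights [q^(4 k n)]: crossing a bond to the right from [n] balances
    crossing it to the left from [n + 1]. *)
Lemma rate_rightE : rate_right = q `^ (4 * k) * rate_left.
Proof. by rewrite /rate_right /rate_left mulrA -powRDq; congr (q `^ _ * _); ring. Qed.

Definition rate_total := rate_left + rate_right.

Lemma rate_total_gt0 : 0 < rate_total.
Proof. by rewrite addr_gt0 ?rate_left_gt0 ?rate_right_gt0. Qed.

Definition hop (u : int -> R) (n : int) : R :=
  rate_left * u (n - 1) + rate_right * u (n + 1).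

Lemma hopE u n : hop u n = rate_left * u (n - 1) + rate_right * u (n + 1).
Proof. by []. Qed.

Lemma shifted_walk c u n :
  shifted (walk_generator q k) (rate_total + c) u n = hop u n + c * u n.
Proof.
by rewrite /shifted /walk_generator /hop /rate_total -/rate_left -/rate_right; ring.
Qed.

Lemma walk_generator_linear (a : R) u v (x : int) :
  walk_generator q k (fun y => a * u y + v y) x =
  a * walk_generator q k u x + walk_generator q k v x.
Proof. by rewrite /walk_generator; ring. Qed.

Lemma walk_generator_bounded (u : int -> R) (M : R) :
  (forall y, setT y -> `|u y| <= M) ->
  forall x, setT x -> `|walk_generator q k u x| <= 2 * rate_total * M.
Proof.
move=> uM x _; rewrite /walk_generator -/rate_left -/rate_right.
have D a b : `|u a - u b| <= 2 * M.
  by rewrite (le_trans (ler_normB _ _))// mulr2n mulrDl mul1r lerD ?uM.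
rewrite (le_trans (ler_normD _ _))// (normrM rate_left) (normrM rate_right).
rewrite (gtr0_norm rate_left_gt0) (gtr0_norm rate_right_gt0).
rewrite (_ : 2 * rate_total * M = rate_left * (2 * M) + rate_right * (2 * M)).
  by rewrite lerD// ler_wpM2l ?D ?ltW ?rate_left_gt0 ?rate_right_gt0.
by rewrite /rate_total; ring.
Qed.

Context (d : measure_display) (Omega : measurableType d).
Context (P : int -> probability Omega R) (m : R -> Omega -> int).
Hypothesis hm : is_markov_chain (walk_generator q k) P m.

(** The additional shift [c] serves the tail estimate, where it gives the walk a weight for holding
    in place. *)
Lemma walk_series (c : R) (f : int -> R) (M t : R) n :
  0 <= c -> (forall y, 0 <= f y <= M) -> 0 <= t ->
  (taylor_poly (fun j => iter j (fun u n => hop u n + c * u n) f n) J).[t]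
    @[J --> \oo] --> expR ((rate_total + c) * t) * markov_mean P m f t n.
Proof.
move=> c0 fM t0; have einj := pickle_int_inj.
have := markov_mean_series einj hm walk_generator_linear walk_generator_bounded
  (c := rate_total + c) (addr_ge0 (ltW rate_total_gt0) c0) fM t0 (x := n) I.
by rewrite (_ : shifted _ _ = fun u n => hop u n + c * u n)//;
  apply/funext => u; apply/funext => x; rewrite shifted_walk.
Qed.

Lemma walk_series0 (f : int -> R) (M t : R) n :
  (forall y, 0 <= f y <= M) -> 0 <= t ->
  (taylor_poly (fun j => iter j hop f n) J).[t]
    @[J --> \oo] --> expR (rate_total * t) * markov_mean P m f t n.
Proof.
move=> fM t0; have := walk_series (c := 0) (n := n) (lexx 0) fM t0.
rewrite addr0 (_ : (fun u n => hop u n + 0 * u n) = hop)//.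
by apply/funext => u; apply/funext => x; rewrite mul0r addr0.
Qed.

Lemma iter_hop_shift (f : int -> R) x j n :
  iter j hop f (n + x) = iter j hop (fun y => f (y + x)) n.
Proof.
elim: j n => //= j IH n; rewrite /hop -!IH.
by rewrite [n - 1 + x]addrAC [n + 1 + x]addrAC.
Qed.

Definition delta (y z : int) : R := (z == y)%:R.

Lemma delta_bounds y z : 0 <= delta y z <= 1.
Proof. by rewrite /delta; case: eqP; rewrite ?lexx ?ler01. Qed.

Lemma iter_hop_delta_shift x j n y :
  iter j hop (delta (y + x)) (n + x) = iter j hop (delta y) n.
Proof.
rewrite iter_hop_shift; congr (iter j hop _ n).
by apply/funext => z; rewrite /delta (inj_eq (addIr x)).
Qed.

(** Induction peels off the first step; translation moves the displaced start into the target, so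
    the induction hypothesis applies, and detailed balance exchanges the left and right terms. *)
Lemma iter_hop_delta_reversible j n y :
  iter j hop (delta y) n = q `^ (4 * k * (y - n)%:~R) * iter j hop (delta n) y.
Proof.
elim: j n y => [|j IH] n y /=.
  rewrite /delta eq_sym; case: eqP => [->|_]; last by rewrite mulr0.
  by rewrite subrr mulr0 powRr0 mulr1.
have E1 : iter j hop (delta y) (n - 1) = iter j hop (delta (y + 1)) n.
  by rewrite -(iter_hop_delta_shift 1) subrK.
have E2 : iter j hop (delta y) (n + 1) = iter j hop (delta (y - 1)) n.
  by rewrite -(iter_hop_delta_shift (-1)) addrK.
rewrite !hopE E1 E2 (IH n (y + 1)) (IH n (y - 1)) rate_rightE.
have -> : 4 * k * (y + 1 - n)%:~R = 4 * k + 4 * k * (y - n)%:~R :> R.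
  by ring.
have -> : 4 * k * (y - n)%:~R = 4 * k + 4 * k * (y - 1 - n)%:~R :> R.
  by ring.
by rewrite !powRDq; ring.
Qed.

Variable t : R.
Hypothesis t0 : 0 <= t.

Definition transition n y : R := markov_mean P m (delta y) t n.

Lemma transitionE n y : (P n (m t @^-1` [set y]) = (transition n y)%:E)%E.
Proof.
rewrite -(markov_mean_indicator pickle_int_inj hm (pred1 y))//.
by congr (P n _); apply/seteqP; split=> w /= /eqP.
Qed.

Lemma transition_ge0 n y : 0 <= transition n y.
Proof. by have /andP[] := markov_mean_bounds pickle_int_inj hm (delta_bounds y) n t0. Qed.

Lemma expR_cancel (x y : R) : expR (rate_total * t) * x = expR (rate_total * t) * y -> x = y.
Proof. by apply: mulfI; rewrite gt_eqF// expR_gt0. Qed.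

Lemma transition_shift x n y : transition (n + x) (y + x) = transition n y.
Proof.
apply: expR_cancel.
have H1 := walk_series0 (n := (n + x)) (delta_bounds (y + x)) t0.
have H2 := walk_series0 (n := n) (delta_bounds y) t0.
have E : (fun j => iter j hop (delta (y + x)) (n + x)) =
    (fun j => iter j hop (delta y) n).
  by apply/funext => j; rewrite iter_hop_delta_shift.
by move: H1; rewrite E => H1; exact: (cvg_unique _ H1 H2).
Qed.

Lemma transition_reversible n y :
  q `^ (4 * k * n%:~R) * transition n y = q `^ (4 * k * y%:~R) * transition y n.
Proof.
suff -> : transition n y = q `^ (4 * k * (y - n)%:~R) * transition y n.
  by rewrite mulrA -powRDq intrB; congr (q `^ _ * _); ring.
apply: expR_cancel.
have H1 := walk_series0 (n := n) (delta_bounds y) t0.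
have H2 : q `^ (4 * k * (y - n)%:~R) * (taylor_poly (fun j => iter j hop (delta n) y) J).[t]
    @[J --> \oo] --> q `^ (4 * k * (y - n)%:~R) * (expR (rate_total * t) * transition y n).
  by apply: cvgMr; exact: (walk_series0 (n := y) (delta_bounds n) t0).
rewrite mulrCA; apply: (cvg_unique _ H1); first exact: Rhausdorff.
apply: (cvg_trans _ H2); apply: near_eq_cvg; near=> J.
rewrite /= !horner_poly mulr_sumr; apply: eq_bigr => j _.
by rewrite (iter_hop_delta_reversible j n y); ring.
Unshelve. all: by end_near. Qed.

(* A path from [n >= b] to the half-line left of [b] passes through [b]; comparing
   coefficients, from [b] on it pays at most the factor [expR (rate_total * t)] to
   be back at [b]. *)
Lemma walk_tail_le (b n : int) : b <= n ->
  markov_mean P m (fun z : int => (z <= b)%R%:R) t n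
  <= expR (rate_total * t) * transition n b.
Proof.
move=> bn; pose f (z : int) : R := (z <= b)%R%:R; pose c := rate_total.
have c0 : 0 <= c := ltW rate_total_gt0.
have fM y : 0 <= f y <= 1 by rewrite /f; case: (y <= b); rewrite ?lexx ?ler01.
have H1 := walk_series0 (n := n) fM t0.
have H2 := walk_series (n := n) c0 (delta_bounds b) t0.
have l0 := ltW rate_left_gt0; have r0 := ltW rate_right_gt0.
have T_le j z : iter j hop f z <= c ^+ j.
  elim: j z => [|j IH] z /=; first by case/andP: (fM z).
  by rewrite /hop exprS {1}/c mulrDl lerD// ler_wpM2l.
pose U := fun u n => hop u n + c * u n.
have U_ge0 j z : 0 <= iter j U (delta b) z.
  elim: j z => [|j IH] z /=; first by case/andP: (delta_bounds b z).
  by rewrite /U /hop !addr_ge0// mulr_ge0.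
(* Holding at [b] in every step, with weight [c], already contributes [c ^+ j]. *)
have U_b j : c ^+ j <= iter j U (delta b) b.
  elim: j => [|j IH] /=; first by rewrite /delta eqxx.
  by rewrite /U exprS -[leLHS]add0r lerD ?ler_wpM2l// /hop addr_ge0// mulr_ge0.
have TU j z : b <= z -> iter j hop f z <= iter j U (delta b) z.
  elim: j z => [|j IH] z bz.
    by rewrite /= /f /delta (_ : (z <= b) = (z == b))%R //; lia.
  (* At [b] itself the two crude bounds meet; strictly above [b] both neighbours are still at least
     [b], so the induction hypothesis covers them. *)
  move: (bz); rewrite le_eqVlt => /orP[/eqP <-|bz'].
    by apply: le_trans (T_le _ _) (U_b _).
  rewrite /= /U /hop -[leLHS]addr0 lerD ?mulr_ge0//.
  by rewrite lerD// ler_wpM2l// IH//; lia.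
(* The two series carry the prefactors [expR (c * t)] and [expR ((c + c) * t)]; their ratio is the
   constant in the claim. *)
suff : expR (c * t) * markov_mean P m f t n <= expR ((c + c) * t) * transition n b.
  by rewrite [(c + c) * t]mulrDl (expRD (c * t)) -mulrA ler_pM2l ?expR_gt0.
apply: (ler_cvg_to H1 H2); near=> J.
rewrite !horner_poly; apply: ler_sum => j _.
by rewrite ler_wpM2r ?exprn_ge0// ler_wpM2r ?invr_ge0// TU.
Unshelve. all: by end_near. Qed.

End Walk.

(** * Finite configurations and the ASIP generator *)

Lemma config_injection : exists e : config -> nat, injective e.
Proof.
pose s (f : config) : seq (int * nat) := [seq (x, f x) | x <- enum_fset (finsupp f)].
exists (fun f => choice.pickle (s f)) => f g /(pcan_inj choice.pickleK) sfg.
have sE (h : config) x : x \in finsupp h -> (x, h x) \in s h.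
  by move=> hx; apply/mapP; exists x.
have sE' (h : config) x v : (x, v) \in s h -> h x = v by move=> /mapP[y _ [-> ->]].
apply/fsfunP => x; have [xf|xf] := boolP (x \in finsupp f).
  by apply/esym/sE'; rewrite -sfg sE.
have [xg|xg] := boolP (x \in finsupp g); last by rewrite !fsfun_dflt.
by apply: sE'; rewrite sfg sE.
Qed.

Section ParticleCount.
Implicit Types (a : int -> bool) (eta : config) (i j x : int).

Lemma moveE eta i j x : move eta i j x =
  if x == i then (eta i).-1 else if x == j then (eta j).+1 else eta x.
Proof. by rewrite /move !fsfun_withE. Qed.

(** Common form of [N], of the particle number and of masses of intervals, so that they share the
    same lemmas. *)
Definition count_in a eta : nat := \big[addn/0%N]_(j \in [set j | a j]) eta j.

Lemma count_inE a eta (r : seq int) : uniq r ->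
  (forall j, j \notin r -> eta j = 0%N) ->
  count_in a eta = (\sum_(j <- r | a j) eta j)%N.
Proof. by move=> ur r0; rewrite (bigfs _ ur)// => j _; exact: r0. Qed.

Lemma sum_indicator a (r : seq int) i : uniq r -> i \in r ->
  (\sum_(x <- r | a x) (x == i))%N = a i.
Proof.
move=> ur ir; rewrite big_mkcond (bigD1_seq i)//= eqxx big1 ?addn0; first by case: (a i).
by move=> x /negPf ->; case: (a x).
Qed.

Lemma count_in_move a eta i j : i != j -> (0 < eta i)%N ->
  (count_in a (move eta i j) + a i = count_in a eta + a j)%N.
Proof.
(* The list must contain [j] as well: it may be empty before the move but is occupied after it. *)
move=> ij etai; pose r := undup [:: i, j & finsupp eta].
have ur : uniq r := undup_uniq _.
have ir : i \in r by rewrite mem_undup inE eqxx.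
have jr : j \in r by rewrite mem_undup !inE eqxx orbT.
have r0 x : x \notin r -> eta x = 0%N.
  by rewrite mem_undup !inE !negb_or => /and3P[_ _ /fsfun_dflt].
rewrite !(count_inE _ ur)//; last first.
  move=> x xr; rewrite moveE (r0 x)//; case: eqP => [xi|_]; first by rewrite xi ir in xr.
  by case: eqP => [xj|//]; rewrite xj jr in xr.
rewrite -[X in (_ + X)%N](sum_indicator a ur ir) -[X in _ = (_ + X)%N](sum_indicator a ur jr).
rewrite -!big_split/=; apply: eq_bigr => x _; rewrite moveE.
have [->|xi] := eqVneq x i; first by rewrite (negPf ij) addn0 addn1 prednK.
by have [->|xj] := eqVneq x j; rewrite ?addn1 ?addn0.
Qed.

Lemma N_recl i eta : N i eta = (eta i + N (i + 1) eta)%N.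
Proof.
pose r := undup (i :: finsupp eta).
have ur : uniq r := undup_uniq _.
have ir : i \in r by rewrite mem_undup inE eqxx.
have r0 x : x \notin r -> eta x = 0%N.
  by rewrite mem_undup !inE !negb_or => /andP[_ /fsfun_dflt].
rewrite -[N i eta]/(count_in (fun j => i <= j) eta).
rewrite -[N (i + 1) eta]/(count_in (fun j => i + 1 <= j) eta).
rewrite !(count_inE _ ur)// !(big_mkcond (fun x => _ <= x)) !(bigD1_seq i ir ur)/= lexx.
rewrite (_ : (i + 1 <= i) = false) ?add0n; last by lia.
congr (_ + _)%N; apply: eq_bigr => x xi.
by rewrite (_ : (i + 1 <= x) = (i <= x)); last by lia.
Qed.

Lemma N_move i eta x y : x != y -> (0 < eta x)%N ->
  (N i (move eta x y) + (i <= x)%R = N i eta + (i <= y)%R)%N.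
Proof. exact: (@count_in_move (fun j => i <= j)). Qed.

End ParticleCount.

Section AsipGenerator.
Context (R : realType) (q k : R).
Implicit Types (eta : config) (f u v : config -> R).

Definition asip_right (a b : nat) : R :=
  q `^ (a%:R - b%:R + (2 * k - 1)) * qnum q a%:R * qnum q (2 * k + b%:R).

Definition asip_left (a b : nat) : R :=
  q `^ (a%:R - b%:R - (2 * k - 1)) * qnum q (2 * k + a%:R) * qnum q b%:R.

Lemma asip_bondE i f eta : asip_bond q k i f eta =
  asip_right (eta i) (eta (i + 1)) * (f (move eta i (i + 1)) - f eta) +
  asip_left (eta i) (eta (i + 1)) * (f (move eta (i + 1) i) - f eta).
Proof. by []. Qed.

Lemma qnum0 : qnum q 0 = 0.
Proof. by rewrite /qnum oppr0 subrr mul0r. Qed.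

Lemma asip_right0 b : asip_right 0 b = 0.
Proof. by rewrite /asip_right qnum0 mulr0 mul0r. Qed.

Lemma asip_left0 a : asip_left a 0 = 0.
Proof. by rewrite /asip_left qnum0 mulr0. Qed.

(** Only possible jumps have to preserve [f]: out of an empty site the rate vanishes with
    [qnum q 0], whatever [move] returns. *)
Lemma asip_bond_eq0 i f eta :
  (0 < eta i -> f (move eta i (i + 1)) = f eta)%N ->
  (0 < eta (i + 1)%R -> f (move eta (i + 1) i) = f eta)%N ->
  asip_bond q k i f eta = 0.
Proof.
rewrite asip_bondE => Hr Hl.
have -> : asip_right (eta i) (eta (i + 1)) * (f (move eta i (i + 1)) - f eta) = 0.
  case: (posnP (eta i)) => [->|/Hr ->]; first by rewrite asip_right0 mul0r.
  by rewrite subrr mulr0.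
rewrite add0r; case: (posnP (eta (i + 1))) => [->|/Hl ->]; first by rewrite asip_left0 mul0r.
by rewrite subrr mulr0.
Qed.

Lemma asip_generator_seqE (r : seq int) f eta : uniq r ->
  (forall i, i \notin r -> asip_bond q k i f eta = 0) ->
  asip_generator q k f eta = \sum_(i <- r) asip_bond q k i f eta.
Proof.
move=> ur r0; rewrite (bigfs _ ur) => [|i _]; last exact: r0.
by rewrite /asip_generator; apply: eq_fsbigl; apply/seteqP; split.
Qed.

(* [i] is listed whenever a particle can cross the bond [(i, i + 1)]. *)
Definition active eta : seq int :=
  undup (enum_fset (finsupp eta) ++ [seq j - 1 | j <- enum_fset (finsupp eta)]).

Lemma notin_active eta i : i \notin active eta -> eta i = 0%N /\ eta (i + 1) = 0%N.
Proof.
rewrite mem_undup mem_cat negb_or => /andP[/fsfun_dflt -> inot]; split=> //.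
apply/eqP; apply: contraNT inot; rewrite -mem_finsupp => i1.
by apply/mapP; exists (i + 1); rewrite ?addrK.
Qed.

Lemma asip_generator_activeE f eta :
  asip_generator q k f eta = \sum_(i <- active eta) asip_bond q k i f eta.
Proof.
apply: asip_generator_seqE; first exact: undup_uniq.
by move=> i /notin_active[e1 e2]; apply: asip_bond_eq0; rewrite ?e1 ?e2.
Qed.

Lemma asip_generator_linear (a : R) u v eta :
  asip_generator q k (fun y => a * u y + v y) eta =
  a * asip_generator q k u eta + asip_generator q k v eta.
Proof.
rewrite !asip_generator_activeE mulr_sumr -big_split/=.
by apply: eq_bigr => i _; rewrite !asip_bondE; ring.
Qed.

Definition particles eta : nat := count_in xpredT eta.

Lemma le_particles eta i : (eta i <= particles eta)%N.
Proof.
have [ni|i0] := posnP (eta i); first by rewrite ni.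
have si : i \in enum_fset (finsupp eta) by rewrite mem_finsupp -lt0n.
rewrite /particles (count_inE _ (fset_uniq (finsupp eta))); last by move=> j /fsfun_dflt.
by rewrite (bigD1_seq i) ?fset_uniq//= leq_addr.
Qed.

Lemma particles_move eta i j : i != j -> (0 < eta i)%N ->
  particles (move eta i j) = particles eta.
Proof. by move=> ij etai; have := count_in_move xpredT ij etai => /addIn. Qed.

(** Occupation numbers are at most [n], so finitely many rates occur, each dominated by their sum
    [c]. The bound for a bond carries the factor [x i + x (i + 1)], which vanishes on idle bonds and
    sums to [2 n]; a difference of values of [u] gives the other factor 2. *)
Lemma asip_generator_bounded (n : nat) : exists C : R,
  forall u (M : R), (forall y, particles y = n -> `|u y| <= M) ->
  forall x, particles x = n -> `|asip_generator q k u x| <= C * M.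
Proof.
pose c : R := \sum_(a < n.+1) \sum_(b < n.+1) (`|asip_right a b| + `|asip_left a b|).
have cle a b : (a <= n)%N -> (b <= n)%N -> `|asip_right a b| + `|asip_left a b| <= c.
  rewrite -ltnS => an; rewrite -[(b <= n)%N]ltnS => bn.
  rewrite /c (bigD1 (Ordinal an))//= (bigD1 (Ordinal bn))//= -addrA lerDl.
  by rewrite addr_ge0// sumr_ge0// => ? _; rewrite ?sumr_ge0// => *; rewrite addr_ge0.
have c0 : 0 <= c by apply: le_trans (cle 0%N 0%N _ _) => //; rewrite addr_ge0.
exists (4 * c * n%:R) => u M uM x xn.
have M0 : 0 <= M by apply: le_trans (uM x xn).
have bond_le i : `|asip_bond q k i u x| <= (2 * c * M) * (x i + x (i + 1)%R)%:R.
  have i1 : i != i + 1 by apply/eqP; lia.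
  have D y : particles y = n -> `|u y - u x| <= 2 * M.
    by move=> yn; rewrite (le_trans (ler_normB _ _))// mulr2n mulrDl mul1r lerD ?uM.
  have an : (x i <= n)%N by rewrite -xn le_particles.
  have bn : (x (i + 1)%R <= n)%N by rewrite -xn le_particles.
  have Hr : `|asip_right (x i) (x (i + 1)) * (u (move x i (i + 1)) - u x)|
      <= 2 * c * M * (x i)%:R.
    have [->|xi] := posnP (x i); first by rewrite asip_right0 mul0r normr0 mulr0.
    rewrite normrM (@le_trans _ _ (c * (2 * M)))//.
      apply: ler_pM => //; last by rewrite D// particles_move.
      by apply: le_trans (cle _ _ an bn); rewrite lerDl.
    by rewrite mulrCA mulrA ler_peMr ?mulr_ge0// ler1n.
  have Hl : `|asip_left (x i) (x (i + 1)) * (u (move x (i + 1) i) - u x)|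
      <= 2 * c * M * (x (i + 1)%R)%:R.
    have [->|xi] := posnP (x (i + 1)%R); first by rewrite asip_left0 mul0r normr0 mulr0.
    rewrite normrM (@le_trans _ _ (c * (2 * M)))//.
      apply: ler_pM => //; last by rewrite D// particles_move// eq_sym.
      by apply: le_trans (cle _ _ an bn); rewrite lerDr.
    by rewrite mulrCA mulrA ler_peMr ?mulr_ge0// ler1n.
  by rewrite asip_bondE natrD [leRHS]mulrDr (le_trans (ler_normD _ _))// lerD.
have sum1 : (\sum_(i <- active x) x i = n)%N.
  rewrite -xn; apply/esym/count_inE => [|j]; first exact: undup_uniq.
  by move=> /notin_active[].
have sum2 : (\sum_(i <- active x) x (i + 1)%R = n)%N.
  rewrite -(big_map (fun i => i + 1) xpredT (fun i => x i)) -xn /particles.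
  apply/esym; apply: count_inE; first by rewrite map_inj_uniq ?undup_uniq//; exact: addIr.
  move=> j jn; have [|//] := boolP (j - 1 \in active x).
    by move=> j1; case/negP: jn; apply/mapP; exists (j - 1); rewrite ?subrK.
  by move=> /notin_active[_]; rewrite subrK.
rewrite asip_generator_activeE (le_trans (ler_norm_sum _ _ _))//.
rewrite (le_trans (ler_sum _ (fun i _ => bond_le i)))//.
rewrite -mulr_sumr -natr_sum big_split/= sum1 sum2 natrD.
by rewrite le_eqVlt; apply/orP; left; apply/eqP; ring.
Qed.

End AsipGenerator.

(** * Duality of heights *)

Section Duality.
Context (R : realType) (q k : R).
Hypotheses (hq0 : 0 < q) (hq1 : q < 1) (hk : 0 < k).
Implicit Types (eta : config).

Definition height (i : int) eta : R := q `^ (2 * (N i eta)%:R).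

Lemma height_gt0 i eta : 0 < height i eta.
Proof. exact: powR_gt0. Qed.

Lemma height_bounds i eta : 0 <= height i eta <= 1.
Proof.
rewrite ltW ?height_gt0//= /height -[leRHS](powRr0 q).
by apply: ger_powR; rewrite ?hq0 ?(ltW hq1) ?mulr_ge0.
Qed.

Lemma height_recl i eta : height i eta = q `^ (2 * (eta i)%:R) * height (i + 1) eta.
Proof. by rewrite /height -powRDq// -mulrDr -natrD -N_recl. Qed.

(* The evolution of the heights is closed: it is that of the walk [- m] acting on [i]. *)
Lemma asip_generator_height i eta :
  asip_generator q k (height i) eta =
  rate_right q k * (height (i - 1) eta - height i eta) +
  rate_left q k * (height (i + 1) eta - height i eta).
Proof.
have neq1 (j : int) : j != j + 1 by apply/eqP; lia.
(* Only the bond between [i - 1] and [i] can change the number of particles at or right of [i]. *)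
rewrite (asip_generator_seqE (r := [:: i - 1]))//; last first.
  move=> j; rewrite inE => ji; apply: asip_bond_eq0 => ej; congr (q `^ (2 * _%:R)).
    have := N_move i (neq1 j) ej.
    by rewrite (_ : (i <= j + 1) = (i <= j)) => [/addIn//|]; lia.
  have := @N_move i eta (j + 1) j; rewrite eq_sym neq1 => /(_ isT ej).
  by rewrite (_ : (i <= j + 1) = (i <= j)) => [/addIn//|]; lia.
rewrite big_seq1 asip_bondE subrK.
pose a := eta (i - 1); pose b := eta i; set h := height i eta.
have qn0 : q != 0 by rewrite gt_eqF.
have Hr : asip_right q k a b * (height i (move eta (i - 1) i) - h) =
    asip_right q k a b * ((q ^+ 2 - 1) * h).
  case: (posnP a) => [->|a0]; first by rewrite asip_right0 !mul0r.
  have := @N_move i eta (i - 1) i; rewrite -{2}[i](subrK 1) neq1 => /(_ isT a0).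
  rewrite lexx (_ : (i <= i - 1) = false); last by lia.
  rewrite addn0 addn1 => E; congr (_ * _); rewrite mulrBl mul1r; congr (_ - _).
  rewrite /h /height E -[(N _ _).+1]addn1 natrD mulrDr powRDq//.
  by rewrite mulr1 -powR_mulrn ?ltW// mulrC.
have Hl : asip_left q k a b * (height i (move eta i (i - 1)) - h) =
    asip_left q k a b * ((q ^- 2 - 1) * h).
  case: (posnP b) => [->|b0]; first by rewrite asip_left0 !mul0r.
  have := @N_move i eta i (i - 1); rewrite eq_sym -{2}[i](subrK 1) neq1 => /(_ isT b0).
  rewrite lexx (_ : (i <= i - 1) = false); last by lia.
  rewrite addn0 addn1 => E; congr (_ * _); rewrite mulrBl mul1r; congr (_ - _).
  rewrite /h /height -E -[(N _ _).+1]addn1 natrD mulrDr powRDq//.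
  rewrite mulr1 -powR_mulrn ?ltW// [RHS]mulrC.
  by rewrite mulfK// powR_eq0 negb_and qn0.
(* The neighbouring heights are [h] times [q^(2 a)] and [q^(-2 b)], so the claim becomes a rational
   identity in [q], [q^(2 k)], [q^a] and [q^b]. *)
have hm : height (i - 1) eta = (q `^ a%:R) ^+ 2 * h.
  by rewrite height_recl subrK mulrDl mul1r powRDq.
have hp : height (i + 1) eta = (q `^ b%:R) ^- 2 * h.
  rewrite /h (height_recl i) mulrA mulrDl mul1r powRDq// -expr2 mulVf ?mul1r//.
  by rewrite expf_neq0// gt_eqF// powR_gt0.
rewrite Hr Hl hm hp /asip_right /asip_left /rate_right /rate_left /qnum.
rewrite !(powRN, powRDq)// !powRr1 ?ltW//.
have x0 : q `^ a%:R != 0 by rewrite gt_eqF// powR_gt0.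
have y0 : q `^ b%:R != 0 by rewrite gt_eqF// powR_gt0.
have K0 : q `^ (2 * k) != 0 by rewrite gt_eqF// powR_gt0.
have qq0 : q * q - 1 != 0.
  by rewrite lt_eqF// subr_lt0 -expr2 exprn_ilt1// ltW.
move: x0 y0 K0; move: (q `^ a%:R) (q `^ b%:R) (q `^ (2 * k)) => x y K x0 y0 K0.
by field; rewrite ?x0 ?y0 ?K0 ?qn0 ?qq0.
Qed.

Local Notation asip_shifted := (shifted (asip_generator q k) (rate_total q k)).

Lemma iter_asip_shifted_linear j (a b : R) (u v : config -> R) eta :
  iter j asip_shifted (fun y => a * u y + b * v y) eta =
  a * iter j asip_shifted u eta + b * iter j asip_shifted v eta.
Proof.
elim: j eta => //= j IH eta; rewrite /shifted.
have -> : iter j asip_shifted (fun y => a * u y + b * v y) =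
    fun y => a * iter j asip_shifted u y + (b * iter j asip_shifted v y + 0).
  by apply/funext => y; rewrite addr0 IH.
have G0 : asip_generator q k (fun=> 0) eta = 0.
  rewrite (_ : (fun=> 0) = fun y => (-1) * u y + u y); last by apply/funext => y; ring.
  by rewrite asip_generator_linear; ring.
by rewrite !asip_generator_linear G0; ring.
Qed.

(** The innermost application is peeled off: it turns one height into two neighbouring ones, and
    linearity carries the other iterates through. The sign flip is there because the right rate
    comes with the height at [i - 1]. *)
Lemma iter_asip_shifted_height j i eta :
  iter j asip_shifted (height i) eta =
  iter j (hop q k) (fun z => height (- z) eta) (- i).
Proof.
elim: j i => [|j IH] i; first by rewrite /= opprK.
rewrite iterSr (_ : asip_shifted (height i) = fun y =>
  rate_left q k * height (i + 1) y + rate_right q k * height (i - 1) y).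
  by rewrite iter_asip_shifted_linear iterS hopE !IH opprD opprB [1 - i]addrC.
by apply/funext => y; rewrite /shifted asip_generator_height /rate_total; ring.
Qed.

Definition single (n : int) : config := [fsfun x in [fset n]%fset => 1%N | 0%N].

Lemma singleE n x : single n x = (x == n).
Proof. by rewrite /single fsfunE inE; case: eqP. Qed.

Lemma single_inj : injective single.
Proof.
move=> n n' /(congr1 (fun f : config => f n)); rewrite !singleE eqxx.
by case: eqP.
Qed.

Lemma move_single n n' : n != n' -> move (single n) n n' = single n'.
Proof.
move=> nn'; apply/fsfunP => x; rewrite moveE !singleE eqxx.
have [->|xn] := eqVneq x n; first by rewrite (negPf nn').
by have [_|//] := eqVneq x n'; rewrite eq_sym (negPf nn').
Qed.

(** A lone particle sees only its two adjacent bonds, and [qnum q 1 = 1] reduces its rates to those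
    of the walk. *)
Lemma asip_generator_single (f : config -> R) n :
  asip_generator q k f (single n) = walk_generator q k (f \o single) n.
Proof.
have n1 : n != n + 1 by apply/eqP; lia.
have n2 : n - 1 != n by apply/eqP; lia.
rewrite (asip_generator_seqE (r := [:: n - 1; n])); first last.
- move=> i; rewrite !inE negb_or => /andP[i1 i2]; apply: asip_bond_eq0.
    by rewrite singleE (negPf i2).
  by rewrite singleE (_ : (i + 1 == n) = false)//; apply/negbTE/eqP; lia.
- by rewrite /= inE n2.
have qnum1 : qnum q 1 = 1.
  rewrite /qnum powRN powRr1 ?ltW// divff// subr_eq0 lt_eqF//.
  by rewrite (lt_trans hq1)// invf_gt1.
rewrite big_cons big_seq1 !asip_bondE subrK !singleE eqxx (negPf n2).
have n3 : n != n - 1 by rewrite eq_sym.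
rewrite [n + 1 == n]eq_sym (negPf n1) asip_right0 asip_left0 !mul0r add0r addr0.
rewrite (move_single n1) (move_single n3).
rewrite /asip_left /asip_right /walk_generator /= !addr0 qnum1 !mulr1.
by congr (q `^ _ * _ * _ + q `^ _ * _ * _); ring.
Qed.

Lemma iter_asip_shifted_single j (f : config -> R) n :
  iter j asip_shifted f (single n) = iter j (hop q k) (f \o single) n.
Proof.
elim: j n => //= j IH n.
rewrite /shifted asip_generator_single -[LHS]/(shifted (walk_generator q k) _ _ n).
rewrite (_ : iter j asip_shifted f \o single = iter j (hop q k) (f \o single)); last first.
  by apply/funext => y /=.
by rewrite -[rate_total q k]addr0 shifted_walk mul0r addr0.
Qed.

Context (d : measure_display) (Omega : measurableType d).
Context (P : config -> probability Omega R) (X : R -> Omega -> config).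
Hypothesis hX : is_markov_chain (asip_generator q k) P X.
Context (d' : measure_display) (Omega' : measurableType d').
Context (Pw : int -> probability Omega' R) (m : R -> Omega' -> int).
Hypothesis hm : is_markov_chain (walk_generator q k) Pw m.
Variable t : R.
Hypothesis t0 : 0 <= t.

Lemma asip_height_duality i eta :
  markov_mean P X (height i) t eta =
  markov_mean Pw m (fun z => height (- z) eta) t (- i).
Proof.
have [e e_inj] := config_injection.
have [C GC] := asip_generator_bounded q k (particles eta).
apply: (@expR_cancel _ q k t).
have c0 : 0 <= rate_total q k by rewrite ltW// rate_total_gt0.
have H1 := markov_mean_series e_inj hX (Z := [set y | particles y = particles eta])
  (asip_generator_linear _ _) GC c0 (height_bounds i) t0 (x := eta) erefl.
have H2 := walk_series0 hq0 hq1 hk hm (n := - i) (fun z => height_bounds (- z) eta) t0.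
apply: (cvg_unique _ H1); first exact: Rhausdorff.
apply: (cvg_trans _ H2); apply: near_eq_cvg; near=> J.
congr horner; congr taylor_poly.
by apply/funext => j; rewrite iter_asip_shifted_height.
Unshelve. all: by end_near. Qed.

Lemma asip_single_mean (f : config -> R) (M : R) n : (forall y, 0 <= f y <= M) ->
  markov_mean P X f t (single n) = markov_mean Pw m (f \o single) t n.
Proof.
move=> fM; have [e e_inj] := config_injection.
apply: (@expR_cancel _ q k t).
have c0 : 0 <= rate_total q k by rewrite ltW// rate_total_gt0.
(* The closed class is that of single-particle configurations, where the walk's bound applies. *)
have GC u (N : R) : (forall y, range single y -> `|u y| <= N) ->
    forall x, range single x -> `|asip_generator q k u x| <= 2 * rate_total q k * N.
  move=> uN _ [y _ <-]; rewrite asip_generator_single.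
  by apply: (walk_generator_bounded hq0 hq1 hk) => // z _; apply: uN; exists z.
have H1 := markov_mean_series e_inj hX (asip_generator_linear _ _) GC c0 fM t0
  (x := single n) (ex_intro2 _ _ n I erefl).
have H2 := walk_series0 hq0 hq1 hk hm (n := n) (fun z => fM (single z)) t0.
apply: (cvg_unique _ H1); first exact: Rhausdorff.
apply: (cvg_trans _ H2); apply: near_eq_cvg; near=> J.
congr horner; congr taylor_poly.
by apply/funext => j; rewrite iter_asip_shifted_single.
Unshelve. all: by end_near. Qed.

Lemma asip_single_transition n y :
  (P (single n) (X t @^-1` [set single y]) = (transition Pw m t n y)%:E)%E.
Proof.
have [e e_inj] := config_injection.
have := markov_mean_indicator e_inj hX (pred1 (single y)) (single n) t0.
rewrite (_ : [set z | pred1 (single y) z] = [set single y]); last first.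
  by apply/seteqP; split=> z /= /eqP.
move=> ->; rewrite (@asip_single_mean _ 1); last first.
  by move=> z; case: (pred1 _ z); rewrite ?lexx ?ler01.
rewrite /transition; congr (markov_mean _ _ _ _ _)%:E; apply/funext => z.
by rewrite /delta /= (inj_eq single_inj).
Qed.

End Duality.

(** * Sums over the integers *)

Section ExtendedSums.
Context (R : realType).
Local Open Scope ereal_scope.

Lemma series_enumeration (S : choiceType) (e : S -> nat) (dec : nat -> option S)
    (a : S -> \bar R) :
  (forall n s, dec n = Some s <-> e s = n) -> (forall s, 0 <= a s) ->
  \sum_(n <oo) oapp a 0 (dec n) = \esum_(s in [set: S]) a s.
Proof.
move=> decP a0.
have b0 n : 0 <= oapp a 0 (dec n) by case: (dec n).
rewrite nneseries_esumT//.
rewrite (_ : \esum_(n in [set: nat]) _ = \esum_(n in range e) oapp a 0 (dec n)).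
  rewrite (@reindex_esum _ _ _ setT (range e) e (fun n => oapp a 0 (dec n))).
    by apply: eq_esum => s _; rewrite (proj2 (decP (e s) s)).
  split; [by move=> s _; exists s|move=> s s' _ _ ee|by move=> n [s _ <-]; exists s].
  have /decP := erefl (e s); rewrite ee => H.
  by have /decP := erefl (e s'); rewrite H => -[].
rewrite [RHS]esum_mkcond; apply: eq_esum => n _; case: ifPn => // nr.
case dn: (dec n) => [s|//]; move/decP: dn => en; case/negP: nr.
by apply/mem_set; exists s.
Qed.

Lemma integral_discrete_esum (S : choiceType) (e : S -> nat) d (T : measurableType d)
    (mu : {measure set T -> \bar R}) (Y : T -> S) (f : S -> \bar R) :
  injective e -> (forall y, measurable (Y @^-1` [set y])) -> (forall s, 0 <= f s) ->
  \int[mu]_w f (Y w) = \esum_(s in [set: S]) f s * mu (Y @^-1` [set s]).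
Proof.
move=> /exists_enumeration[dec decP] mY f0.
rewrite (ge0_integral_discrete decP mY)//.
by rewrite (series_enumeration decP (a := fun s => f s * mu (Y @^-1` [set s])))// => s;
  exact: mule_ge0.
Qed.

Lemma esum_swap (S T : choiceType) (a : S -> T -> \bar R) :
  (forall s t, 0 <= a s t) ->
  \esum_(s in [set: S]) \esum_(t in [set: T]) a s t =
  \esum_(t in [set: T]) \esum_(s in [set: S]) a s t.
Proof.
move=> a0; rewrite !esum_esum//.
rewrite (@reindex_esum _ _ _ ([set: T] `*`` fun=> [set: S]) _ (fun x => (x.2, x.1)))//.
split=> //=; first by move=> [s t] [s' t'] _ _ /= [-> ->].
by move=> [s t] _; exists (t, s).
Qed.

Lemma esum_subset (S : choiceType) (A B : set S) (a : S -> \bar R) :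
  A `<=` B -> (forall s, 0 <= a s) -> \esum_(s in A) a s <= \esum_(s in B) a s.
Proof.
move=> AB a0; rewrite esum_mkcond [leRHS]esum_mkcond; apply: le_esum => s _.
case: ifPn => [/set_mem/AB/mem_set ->//|_].
by case: ifPn.
Qed.

Lemma ge0_esumZl (S : choiceType) (A : set S) (c : R) (a : S -> \bar R) :
  (0 <= c)%R -> (forall s, 0 <= a s) ->
  \esum_(s in A) (c%:E * a s) = c%:E * \esum_(s in A) a s.
Proof.
(* One inequality suffices: used with [c^-1] it gives the converse, apart from [c = 0]. *)
have le (c' : R) (b : S -> \bar R) : (0 <= c')%R -> (forall s, 0 <= b s) ->
    \esum_(s in A) (c'%:E * b s) <= c'%:E * \esum_(s in A) b s.
  move=> c0 b0; apply: ge_ereal_sup => _ [X XA <-].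
  rewrite -ge0_mule_fsumr// lee_wpmul2l ?lee_fin//.
  by apply: esum_ge; exists X.
move=> c0 a0; apply/eqP; rewrite eq_le le//=.
have [c00|cn0] := eqVneq c 0%R.
  by rewrite c00 mul0e esum_ge0// => s _; rewrite mul0e.
have {cn0}c0 : (0 < c)%R by rewrite lt_neqAle eq_sym cn0.
rewrite [leLHS](_ : _ = c%:E * \esum_(s in A) (c^-1%:E * (c%:E * a s))); last first.
  congr (_ * _); apply: eq_esum => s _.
  by rewrite muleA -EFinM mulVf ?gt_eqF// mul1e.
apply: (@le_trans _ _ (c%:E * (c^-1%:E * \esum_(s in A) (c%:E * a s)))).
  rewrite lee_wpmul2l ?lee_fin ?(ltW c0)// le ?invr_ge0 ?(ltW c0)// => s.
  by rewrite mule_ge0// lee_fin ltW.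
by rewrite muleA -EFinM divff ?gt_eqF// mul1e.
Qed.

Definition box (L : nat) : set int := [set x : int | (`|x| <= L%:Z)%R].

Lemma esum_box_cvg (D : set int) (a : int -> \bar R) : (forall x, 0 <= a x) ->
  \esum_(x in D `&` box L) a x @[L --> \oo] --> \esum_(x in D) a x.
Proof.
move=> a0.
have ndL : nondecreasing_seq (fun L => \esum_(x in D `&` box L) a x).
  apply/nondecreasing_seqP => L; apply: esum_subset => // x [Dx].
  by rewrite /box /= => xL; split=> //=; lia.
have := ereal_nondecreasing_cvgn ndL; set s := ereal_sup _ => sP.
suff <- : s = \esum_(x in D) a x by [].
apply/eqP; rewrite eq_le; apply/andP; split.
  by apply: ge_ereal_sup => _ [L _ <-]; apply: esum_subset => // x [].
apply: ge_ereal_sup => _ [X [finX XD] <-].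
have [L XL] : exists L, X `<=` box L.
  (* The sum of all absolute values is a crude common radius. *)
  have /finite_fsetP[F XF] := finX; exists (\sum_(x <- F) `|x|)%N => x Xx.
  have xF : x \in F by move: Xx; rewrite XF.
  by rewrite /box/= (big_fsetD1 x)//=; lia.
apply: (@le_trans _ _ (\esum_(x in D `&` box L) a x)).
  by apply: esum_ge; exists X => //; split=> // x Xx; split; [exact: XD|exact: XL].
by apply: ereal_sup_ubound; exists L.
Qed.

Lemma esum_lt_series (i : int) (a : int -> \bar R) : (forall x, 0 <= a x) ->
  \esum_(x in [set x : int | (x < i)%R]) a x = \sum_(j <oo) a (i - 1 - j%:Z)%R.
Proof.
move=> a0; rewrite nneseries_esumT//.
rewrite (@reindex_esum _ _ _ setT _ (fun j : nat => i - 1 - j%:Z)%R)//.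
split=> [j _ /=|j j' _ _ /=|x /= xi]; [lia|lia|].
by exists (absz (i - 1 - x)%R) => //; lia.
Qed.

(** Since [g] is constant up to [lo], the partial sums are eventually constant; [lo] may lie on
    either side of [i]. *)
Lemma esum_lt_telescope (i lo : int) (g : int -> R) :
  (forall x, (x < lo)%R -> g (x + 1)%R = g x) ->
  (forall x, (g x <= g (x + 1))%R) ->
  \esum_(x in [set x : int | (x < i)%R]) (g (x + 1) - g x)%:E = (g i - g lo)%:E.
Proof.
move=> glo gmono; rewrite esum_lt_series; last by move=> x; rewrite lee_fin subr_ge0.
have gE x : (x <= lo)%R -> g x = g lo.
  move=> xlo; rewrite (_ : x = lo - (absz (lo - x)%R)%:Z)%R; last by lia.
  elim: (absz _) => [|n IH]; first by rewrite subr0.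
  by rewrite -IH -[LHS]glo; [congr g; lia|lia].
have sumE J : (\sum_(0 <= j < J) (g (i - 1 - j%:Z + 1) - g (i - 1 - j%:Z)) =
    g i - g (i - J%:Z))%R.
  elim: J => [|J IH]; first by rewrite big_nil subr0 subrr.
  rewrite big_nat_recr//= IH (_ : i - 1 - J%:Z + 1 = i - J%:Z)%R; last by lia.
  by rewrite (_ : i - 1 - J%:Z = i - J.+1%:Z)%R ?subrKA//; lia.
apply: cvg_lim => //; apply: cvg_near_cst; near=> J.
rewrite sumEFin sumE (gE (i - J%:Z)%R)//.
have : (absz (i - lo)%R <= J)%N by near: J; exact: nbhs_infty_ge.
by lia.
Unshelve. all: by end_near. Qed.

End ExtendedSums.

(** * Truncated configurations *)

Section Truncation.
Implicit Types (eta : int -> nat) (zeta : config) (x i : int).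

Lemma Ndiff_config zeta x i : Ndiff zeta x i = (N x zeta)%:Z - (N i zeta)%:Z.
Proof.
have N_split (y z : int) : y <= z ->
    N y zeta = (\big[addn/0%N]_(j \in [set j : int | (y <= j < z)%R]) zeta j + N z zeta)%N.
  move=> yz; have ur := fset_uniq (finsupp zeta).
  have r0 j : j \notin enum_fset (finsupp zeta) -> zeta j = 0%N by move=> /fsfun_dflt.
  rewrite -[N y zeta]/(count_in (fun j => y <= j) zeta).
  rewrite -[N z zeta]/(count_in (fun j => z <= j) zeta).
  rewrite -[X in (X + _)%N]/(count_in (fun j => y <= j < z) zeta).
  rewrite !(count_inE _ ur r0) (bigID (fun j => j < z))/=; congr (_ + _)%N.
  by apply: eq_bigl => j; lia.
rewrite /Ndiff; case: leP => [/N_split ->|/ltW/N_split ->]; lia.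
Qed.

Lemma eq_Ndiff (f g : int -> nat) x i :
  (forall j, x <= j < i -> f j = g j) -> (forall j, i <= j < x -> f j = g j) ->
  Ndiff f x i = Ndiff g x i.
Proof.
move=> fg1 fg2; rewrite /Ndiff; case: ifP => _.
  by congr (Posz _); apply: eq_fsbigr => j; rewrite inE /= => /fg1.
by congr (- Posz _); apply: eq_fsbigr => j; rewrite inE /= => /fg2.
Qed.

(** Between two sites of the box nothing is cut off; this is why the summands of the current moment
    do not depend on [L]. *)
Lemma Ndiff_trunc eta (L : nat) x i : `|x| <= L%:Z -> `|i| <= L%:Z ->
  (N x (trunc_config eta L))%:Z - (N i (trunc_config eta L))%:Z = Ndiff eta x i.
Proof.
move=> xL iL; rewrite -Ndiff_config; apply: eq_Ndiff => j jx;
  by rewrite trunc_configE ifT//; lia.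
Qed.

Lemma trunc_config_box eta (L : nat) x : `|x| <= L%:Z -> trunc_config eta L x = eta x.
Proof. by rewrite trunc_configE => ->. Qed.

Lemma trunc_config_out eta (L : nat) x : L%:Z < `|x| -> trunc_config eta L x = 0%N.
Proof. by rewrite trunc_configE ltNge => /negPf ->. Qed.

End Truncation.

Section HeightIncrement.
Context (R : realType) (q : R).
Hypotheses (hq0 : 0 < q) (hq1 : q < 1).
Implicit Types (eta : int -> nat) (zeta : config) (x i : int).

Lemma height_mono zeta x : height q x zeta <= height q (x + 1) zeta.
Proof.
rewrite (height_recl hq0) ler_piMl ?(ltW (height_gt0 hq0 _ _))//.
by rewrite -[leRHS](powRr0 q) ger_powR ?mulr_ge0// hq0 ltW.
Qed.

(** Infinite-volume form of the height difference across [x] divided by the height at [i], which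
    needs no total mass to the right. Its opposite occurs in the expectations of the theorem. *)
Definition increment eta i x : R :=
  (q `^ (- (2 * (eta x)%:R)) - 1) * q `^ (2 * (Ndiff eta x i)%:~R).

Lemma increment_ge0 eta i x : 0 <= increment eta i x.
Proof.
rewrite /increment mulr_ge0 ?powR_ge0// subr_ge0 -[leLHS](powRr0 q).
by rewrite ger_powR ?oppr_le0 ?mulr_ge0// hq0 ltW.
Qed.

Lemma height_trunc eta (L : nat) i x : `|i| <= L%:Z -> 
  (height q (x + 1) (trunc_config eta L) - height q x (trunc_config eta L))
    / height q i (trunc_config eta L)
  = if `|x| <= L%:Z then increment eta i x else 0.
Proof.
move=> iL; set zeta := trunc_config eta L.
have h0 j : height q j zeta != 0 by rewrite gt_eqF// height_gt0.
case: ifPn => [xL|]; last first.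
  rewrite -ltNge => xL; rewrite [height q x _](height_recl hq0) trunc_config_out//.
  by rewrite mulr0 powRr0 mul1r subrr mul0r.
have -> : height q (x + 1) zeta = q `^ (- (2 * (eta x)%:R)) * height q x zeta.
  rewrite (height_recl hq0 x) trunc_config_box// mulrA -powRDq// addNr powRr0 mul1r//.
rewrite -[X in _ - X]mul1r -mulrBl -mulrA; congr (_ * _).
rewrite -(@Ndiff_trunc eta L)// /height -powRN -powRDq//; congr (q `^ _).
by rewrite intrB; ring.
Qed.

End HeightIncrement.

(** * Walk expectations as sums over tail probabilities *)

Lemma mem_below (i n : int) : (n \in [set n : int | n < i]) = (n < i).
Proof. by apply/idP/idP => [/set_mem|ni]; [|exact: mem_set]. Qed.

Section WalkSums.
Context (R : realType) (q k : R).
Hypotheses (hq0 : 0 < q) (hq1 : q < 1) (hk : 0 < k).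
Context (d : measure_display) (Omega : measurableType d).
Context (P : int -> probability Omega R) (m : R -> Omega -> int).
Hypothesis hm : is_markov_chain (walk_generator q k) P m.
Variables (t : R) (i : int).
Hypothesis t0 : 0 <= t.
Local Notation p := (transition P m t).
Local Open Scope ereal_scope.

Lemma walk_integral_esum (f : int -> R) n : (forall y, 0 <= f y)%R ->
  \int[P n]_w (f (m t w))%:E = \esum_(y in [set: int]) (f y * p n y)%:E.
Proof.
move=> f0; have mm y := markov_measurable hm y t0.
rewrite (integral_discrete_esum (P n) (f := EFin \o f) pickle_int_inj mm)//.
by apply: eq_esum => y _; rewrite EFinM -(transitionE hm t0).
Qed.

Lemma esum_transition n : \esum_(y in [set: int]) (p n y)%:E = 1.
Proof.
rewrite -(probability_setT (P n)) -[RHS]mul1e -integral_cst//.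
rewrite (walk_integral_esum (f := fun=> 1%R))//.
by apply: eq_esum => y _; rewrite mul1r.
Qed.

(** The event is [m t < i], written with [i - 1] to match [walk_tail_le] at [b = i - 1]. *)
Definition tail_prob (x : int) : R := markov_mean P m (fun z : int => (z <= i - 1)%R%:R) t x.

Lemma tail_prob_bounds x : (0 <= tail_prob x <= 1)%R.
Proof.
apply: (markov_mean_bounds pickle_int_inj hm) => // y.
by case: (y <= i - 1)%R; rewrite ?lexx ?ler01.
Qed.

Lemma tail_probE x :
  (tail_prob x)%:E = \esum_(n in [set n : int | (n < i)%R]) (p x n)%:E.
Proof.
rewrite /tail_prob -(markov_meanE pickle_int_inj hm (M := 1))//; last first.
  by move=> y; case: (y <= i - 1)%R; rewrite ?lexx ?ler01.
rewrite unlock (walk_integral_esum (f := fun z : int => (z <= i - 1)%R%:R))//.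
rewrite [RHS]esum_mkcond; apply: eq_esum => y _.
rewrite mem_below (_ : (y <= i - 1)%R = (y < i)%R); last by lia.
by case: ifP => _; rewrite ?mul1r ?mul0r.
Qed.

(* By reversibility, [q^(4kn) P_n(m = x) = q^(4kx) P_x(m = n)], which is then summed
   over [n < i]. *)
Lemma reversed_walk_sum (g : int -> R) : (forall y, 0 <= g y)%R ->
  \sum_(0 <= j <oo) (q `^ (4 * k * (i - 1 - j%:Z)%:~R))%:E *
    \int[P (i - 1 - j%:Z)%R]_w (q `^ (- (4 * k * (m t w)%:~R)) * g (m t w))%:E
  = \esum_(x in [set: int]) (g x * tail_prob x)%:E.
Proof.
move=> g0; have p0 n y : (0 <= p n y)%R := transition_ge0 hm t0 n y.
rewrite -(esum_lt_series i (a := fun n => (q `^ (4 * k * n%:~R))%:E *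
    \int[P n]_w (q `^ (- (4 * k * (m t w)%:~R)) * g (m t w))%:E)); last first.
  move=> n; rewrite mule_ge0 ?lee_fin ?powR_ge0//; apply: integral_ge0 => w _.
  by rewrite lee_fin mulr_ge0 ?powR_ge0.
transitivity (\esum_(n in [set: int]) \esum_(x in [set: int])
    (if (n < i)%R then (g x * p x n)%:E else 0)).
  rewrite esum_mkcond; apply: eq_esum => n _.
  rewrite mem_below; case: ifP => ni; last by rewrite esum1.
  rewrite (walk_integral_esum (f := fun y => q `^ (- (4 * k * y%:~R)) * g y)%R); last first.
    by move=> y; rewrite mulr_ge0 ?powR_ge0.
  rewrite -ge0_esumZl ?powR_ge0//; last first.
    by move=> y; rewrite lee_fin !mulr_ge0 ?powR_ge0.
  apply: eq_esum => y _; rewrite -EFinM; congr EFin.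
  have E := transition_reversible hq0 hq1 hk hm t0 n y.
  transitivity (g y * ((q `^ (4 * k * y%:~R))^-1 * (q `^ (4 * k * n%:~R) * p n y)))%R.
    by rewrite powRN; ring.
  by rewrite E mulKf// gt_eqF// powR_gt0.
rewrite esum_swap; last first.
  by move=> n x; case: ifP => //; rewrite lee_fin mulr_ge0.
apply: eq_esum => x _; rewrite EFinM tail_probE -ge0_esumZl//; last by move=> s; rewrite lee_fin.
rewrite [RHS]esum_mkcond; apply: eq_esum => n _.
by rewrite mem_below; case: ifP => _ //; rewrite EFinM.
Qed.

(** The value [g (- m t)] is [g lo] plus the increments at all [x < - m t]. Translating the walk by
    [x + i] turns the event [x < - m t] under the start [- i] into [m t < i] under the start [x]. *)
Lemma walk_height_sum (g : int -> R) (lo : int) :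
  (forall x, (x < lo)%R -> g (x + 1)%R = g x) ->
  (forall x, g x <= g (x + 1))%R -> (0 <= g lo)%R ->
  \int[P (- i)%R]_w (g (- m t w)%R)%:E =
  (g lo)%:E + \esum_(x in [set: int]) ((g (x + 1) - g x) * tail_prob x)%:E.
Proof.
move=> glo gmono glo0; have p0 n y : (0 <= p n y)%R := transition_ge0 hm t0 n y.
have tel y := esum_lt_telescope (- y) glo gmono.
have d0 x : (0 <= g (x + 1) - g x)%R by rewrite subr_ge0.
have g_lo y : (0 <= g (- y) - g lo)%R.
  by rewrite -lee_fin -tel esum_ge0// => x _; rewrite lee_fin.
have g0 y : (0 <= g (- y))%R.
  by rewrite -[g _](subrK (g lo)) addr_ge0.
rewrite (walk_integral_esum (f := fun y => g (- y)%R))//.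
transitivity (\esum_(y in [set: int]) ((g lo)%:E * (p (- i)%R y)%:E +
   (g (- y) - g lo)%:E * (p (- i)%R y)%:E)).
  by apply: eq_esum => y _; rewrite -!EFinM -EFinD; congr EFin; ring.
rewrite esumD; [|by move=> y _; rewrite mule_ge0 ?lee_fin..].
rewrite ge0_esumZl// ?esum_transition ?mule1; last by move=> y; rewrite lee_fin.
congr (_ + _).
transitivity (\esum_(y in [set: int]) \esum_(x in [set: int])
    (if (x < - y)%R then ((g (x + 1) - g x) * p (- i)%R y)%:E else 0)).
  apply: eq_esum => y _; rewrite -tel muleC -ge0_esumZl//.
  rewrite esum_mkcond; apply: eq_esum => x _; rewrite mem_below /=.
  by case: ifP => _ //; rewrite -EFinM mulrC.
rewrite esum_swap; last first.
  by move=> n x; case: ifP => //; rewrite lee_fin mulr_ge0.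
apply: eq_esum => x _; rewrite EFinM tail_probE -ge0_esumZl//; last first.
  by move=> n; rewrite lee_fin.
rewrite [RHS]esum_mkcond.
rewrite [RHS](@reindex_esum _ _ _ [set: int] _ (fun y => y + x + i)%R).
  apply: eq_esum => y _; rewrite mem_below /= (_ : (y + x + i < i)%R = (x < - y)%R); last by lia.
  case: ifP => _ //; rewrite -EFinM; congr (_ * _)%:E.
  rewrite -[RHS](transition_shift hq0 hq1 hk hm t0 (- (x + i))%R).
  by congr (transition _ _ _ _ _); lia.
split=> //= [y y' _ _ E|y _]; first by lia.
by exists (y - x - i)%R => //; lia.
Qed.

End WalkSums.

(** * The current in infinite volume *)

Lemma nbhs_infty_box (i : int) : \forall L \near \oo, `|i| <= L%:Z.
Proof.
near=> L; have : (`|i| <= L)%N by near: L; exact: nbhs_infty_ge.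
by lia.
Unshelve. all: by end_near. Qed.

Lemma mem_box (L : nat) (x : int) : (x \in box L) = (`|x| <= L%:Z).
Proof. by apply/idP/idP => [/set_mem|?]; [|apply/mem_set]. Qed.

Section CurrentMoment.
Context (R : realType) (q k : R).
Hypotheses (hq0 : 0 < q) (hq1 : q < 1) (hk : 0 < k).
Context (d : measure_display) (Omega : measurableType d).
Context (P : config -> probability Omega R) (X : R -> Omega -> config).
Hypothesis hX : is_markov_chain (asip_generator q k) P X.
Context (d' : measure_display) (Omega' : measurableType d').
Context (Pw : int -> probability Omega' R) (m : R -> Omega' -> int).
Hypothesis hm : is_markov_chain (walk_generator q k) Pw m.
Context (eta : int -> nat) (i : int) (t : R).
Hypothesis t0 : 0 <= t.
Local Notation zeta := (trunc_config eta).
Local Notation p := (transition Pw m t).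
Local Notation tailp := (tail_prob Pw m t i).
Local Notation h := (height q).

Lemma height_trunc_below (L : nat) x : x < - L%:Z -> h (x + 1) (zeta L) = h x (zeta L).
Proof.
move=> xL; rewrite [RHS](height_recl hq0) trunc_config_out; last by clear -xL; lia.
by rewrite mulr0 powRr0 mul1r.
Qed.

Local Open Scope ereal_scope.

Lemma trunc_current_moment (L : nat) : (`|i| <= L%:Z)%R ->
  'E_(P (zeta L))[fun w => (q `^ (2 * (current (zeta L) (X t w) i)%:~R))%R] =
  (h (- L%:Z) (zeta L) / h i (zeta L))%:E +
  \esum_(x in box L) (increment q eta i x * tailp x)%:E.
Proof.
move=> iL; have [e e_inj] := config_injection.
have [dec decP] := exists_enumeration e_inj.
have hi0 : (0 < h i (zeta L))%R := height_gt0 hq0 _ _.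
have mX y := markov_measurable hX y t0.
transitivity ((h i (zeta L))^-1%:E * \int[P (zeta L)]_w (h i (X t w))%:E).
  rewrite unlock -ge0_integralZl_EFin//.
  - apply: eq_integral => w _; rewrite -EFinM; congr EFin.
    rewrite /current /height -powRN -powRDq//; congr (q `^ _)%R.
    by rewrite intrB; ring.
  - by move=> w _; rewrite lee_fin ltW// height_gt0.
  - by apply/measurable_EFinP; exact: (measurable_fun_discrete decP mX).
  - by rewrite invr_ge0 ltW.
have -> : \int[P (zeta L)]_w (h i (X t w))%:E =
    \int[Pw (- i)%R]_w (h (- m t w)%R (zeta L))%:E.
  have := markov_meanE e_inj hX (height_bounds hq0 hq1 i) (zeta L) t0.
  rewrite unlock => ->; rewrite (asip_height_duality hq0 hq1 hk hX hm)//.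
  have := markov_meanE pickle_int_inj hm
    (fun z => height_bounds hq0 hq1 (- z) (zeta L)) (- i)%R t0.
  by rewrite unlock => ->.
(* The choice [lo = - L] is allowed because truncated heights are constant to the left of the
   box. *)
rewrite (walk_height_sum hq0 hq1 hk hm i t0 (g := fun x => h x (zeta L)) (lo := - L%:Z)%R).
- have r0 x : (0 <= tailp x)%R by case/andP: (tail_prob_bounds hm i t0 x).
  have lo0 : 0 <= (h (- L%:Z) (zeta L))%:E by rewrite lee_fin ltW// height_gt0.
  rewrite (ge0_muleDr _ lo0); last first.
    rewrite esum_ge0// => x _; rewrite lee_fin mulr_ge0// subr_ge0.
    exact: height_mono.
  congr (_ + _); first by rewrite -EFinM mulrC.
  rewrite -ge0_esumZl ?invr_ge0 ?ltW//; last first.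
    by move=> x; rewrite lee_fin mulr_ge0// subr_ge0 height_mono.
  rewrite [RHS]esum_mkcond; apply: eq_esum => x _.
  rewrite -EFinM mulrA [X in (X * _)%R]mulrC (height_trunc hq0)//.
  by rewrite mem_box; case: ifP => _; rewrite ?mul0r.
- by move=> x; exact: height_trunc_below.
- by move=> x; exact: height_mono.
- by rewrite ltW// height_gt0.
Qed.

(** In each box the sum is 1 minus the ratio of the heights at [- L] and [i]; the bound survives the
    limit. *)
Lemma increment_below_le1 :
  \esum_(x in [set x : int | (x < i)%R]) (increment q eta i x)%:E <= 1.
Proof.
have inc0 x : 0 <= (increment q eta i x)%:E by rewrite lee_fin increment_ge0.
have cv := esum_box_cvg (D := [set x : int | (x < i)%R]) inc0.
apply: (cvge_le _ cv); near=> L; have iL : (`|i| <= L%:Z)%R by near: L; exact: nbhs_infty_box.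
have hi0 : (0 < h i (zeta L))%R := height_gt0 hq0 _ _.
have := esum_lt_telescope i (@height_trunc_below L) (fun x => height_mono hq0 hq1 (zeta L) x).
move=> /(congr1 (fun z => (h i (zeta L))^-1%:E * z)); rewrite -ge0_esumZl; first last.
- by move=> x; rewrite lee_fin subr_ge0 height_mono.
- by rewrite invr_ge0 ltW.
rewrite -EFinM => E.
apply: (@le_trans _ _ ((h i (zeta L))^-1 * (h i (zeta L) - h (- L%:Z) (zeta L)))%:E).
  rewrite -E le_eqVlt; apply/orP; left; apply/eqP.
  rewrite esum_mkcondr; apply: eq_esum => x _.
  rewrite -EFinM mulrC (height_trunc hq0)//.
  by rewrite mem_box; case: ifP.
rewrite lee_fin mulrBr mulVf ?gt_eqF// gerBl mulr_ge0 ?invr_ge0 ?ltW//.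
exact: height_gt0.
Unshelve. all: by end_near. Qed.

Lemma fsbig_setT1 (b : int) (f : int -> R) :
  (forall j, j != b -> f j = 1%R) -> \big[*%R/1%R]_(j \in [set: int]) f j = f b.
Proof.
move=> f1; rewrite (_ : [set: int] = [set` xpredT]); last by apply/seteqP; split.
by rewrite -(@bigfs _ _ _ _ [:: b])// ?big_seq1// => j _; rewrite inE; exact: f1.
Qed.

Lemma qpoch_ge0 (x : R) n : (0 <= x)%R -> (x <= 1)%R -> (0 <= qpoch x (q ^+ 2) n)%R.
Proof.
move=> x0 x1; apply: prodr_ge0 => j _; rewrite subr_ge0 -exprM.
by rewrite mulr_ile1// ?exprn_ge0 ?exprn_ile1// ltW.
Qed.

Lemma duality_ge0 (z xi : config) : (0 <= duality q k z xi)%R.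
Proof.
have q_le1 (a : R) : (0 <= a)%R -> (q `^ a <= 1)%R.
  by move=> a0; rewrite -[leRHS](powRr0 q) ger_powR// hq0 ltW.
(* If [xi j] exceeds [z j] the indicator kills the factor; otherwise the exponent is nonnegative and
   the Pochhammer argument is at most 1. *)
apply: prodr_ge0 => j _; case: (leqP (xi j) (z j)) => [xz|_]; last by rewrite mulr0.
rewrite mulr1 mulr_ge0 ?powR_ge0// divr_ge0 ?qpoch_ge0 ?powR_ge0 ?q_le1//.
  by rewrite mulr_ge0// addr_ge0// subr_ge0 ler_nat.
by rewrite ltW// mulr_gt0.
Qed.

(** This links goodness to heights: [1 - q^(2 z_y)] times the height at [y + 1] is the height
    increment at [y], and the other factor is the inverse reversible weight. *)
Lemma duality_single (z : config) (y : int) :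
  duality q k z (single y) =
  (q / (1 - q `^ (4 * k)) * (q `^ (- (4 * k * y%:~R)) * (h (y + 1) z - h y z)))%R.
Proof.
rewrite /duality (fsbig_setT1 (b := y)); last first.
  by move=> j /negPf jy; rewrite singleE jy /qpoch !big_ord0 /= mulr0n mulr0 powRr0 divr1 !mulr1.
rewrite singleE eqxx /qpoch !big_ord1 expr0 !mulr1 subrK.
rewrite (height_recl hq0 y) /height.
case: (posnP (z y)) => [->|zy].
  by rewrite /= mulr0n !mulr0 powRr0 mul1r subrr !mulr0.
rewrite /= mulr1n mulr1 !powRDq// powRr1 ?ltW//.
by ring.
Qed.

End CurrentMoment.

Section InfiniteVolume.
Context (R : realType) (q k : R).
Hypotheses (hq0 : 0 < q) (hq1 : q < 1) (hk : 0 < k).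
Context (d : measure_display) (Omega : measurableType d).
Context (P : config -> probability Omega R) (X : R -> Omega -> config).
Hypothesis hX : is_markov_chain (asip_generator q k) P X.
Context (d' : measure_display) (Omega' : measurableType d').
Context (Pw : int -> probability Omega' R) (m : R -> Omega' -> int).
Hypothesis hm : is_markov_chain (walk_generator q k) Pw m.
Context (eta : int -> nat) (i : int) (t : R).
Hypothesis t0 : 0 <= t.
Local Notation zeta := (trunc_config eta).
Local Notation p := (transition Pw m t).
Local Notation tailp := (tail_prob Pw m t i).
Local Notation h := (height q).
Local Open Scope ereal_scope.

(* [config] has no [choiceType] structure, which [esum] needs: hence [classic]. *)
Lemma asip_single_expectation_ge (f : config -> R) b : (forall y, 0 <= f y)%R ->
  \esum_(y in [set: int]) (f (single y) * p b y)%:E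
  <= 'E_(P (single b))[fun w => f (X t w)].
Proof.
move=> f0; have [e e_inj] := config_injection; rewrite unlock.
have mX y := markov_measurable hX y t0.
rewrite (@integral_discrete_esum _ {classic config} e _ _ (P (single b)) (X t) (EFin \o f))//.
(* Discarding all other configurations costs nothing, as only a lower bound is wanted; [f] is not
   assumed bounded, so transition probabilities are used. *)
apply: (@le_trans _ _ (\esum_(s in (range single : set {classic config}))
   ((f s)%:E * P (single b) (X t @^-1` [set s])))); last first.
  by apply: esum_subset => // s; apply: mule_ge0 => //; rewrite lee_fin; exact: f0.
rewrite (@reindex_esum R int {classic config} [set: int] (range single) single).
  apply: le_esum => y _.
  by rewrite EFinM -(asip_single_transition hq0 hq1 hk hX hm t0).
by split=> [y _|y y' _ _ /single_inj|_ [y _ <-]] //; exists y.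
Qed.

(** By reversibility the normalised dual expectation from a particle at [i - 1] dominates [c] times
    each box sum, and its limit is finite. *)
Lemma good_increment_sum : good q k P X eta ->
  \esum_(x in [set: int]) (increment q eta i x * p x (i - 1)%R)%:E < +oo.
Proof.
move=> /(_ t (single (i - 1)%R) t0)[l].
set b := (i - 1)%R; set a := fun L : nat => _ => al.
have p0 x y : (0 <= p x y)%R := transition_ge0 hm t0 x y.
have qk : (0 < 1 - q `^ (4 * k))%R.
  rewrite subr_gt0 /powR gt_eqF// expR_lt1 pmulr_rlt0 ?mulr_gt0//.
  by rewrite ln_lt0// hq0.
(* What remains after reversibility trades [q^(-4 k y) p b y] for [q^(-4 k b) p y b]. *)
pose c : R := (q / (1 - q `^ (4 * k)) * q `^ (- (4 * k * b%:~R)))%R.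
have c0 : (0 < c)%R by rewrite mulr_gt0 ?powR_gt0// divr_gt0.
have inc0 x : 0 <= (increment q eta i x * p x b)%:E.
  by rewrite lee_fin mulr_ge0// increment_ge0.
have a_ge : \forall L \near \oo,
    \esum_(x in setT `&` box L) (increment q eta i x * p x b)%:E <= c^-1%:E * a L.
  near=> L; have iL : (`|i| <= L%:Z)%R by near: L; exact: nbhs_infty_box.
  have hi0 : (0 < h i (zeta L))%R := height_gt0 hq0 _ _.
  (* Only the factor at [b] differs from 1. As [b + 1 = i], it is the inverse height at [i], the
     normalisation used in [increment]; this dictates the site of the dual particle. *)
  rewrite /a (fsbig_setT1 (b := b)); last first.
    by move=> j /negPf jb; rewrite singleE jb /= mulr0n mulr0 mul0r oppr0 powRr0.
  rewrite singleE eqxx subrK /= mulr1n mulr1 powRN -/(h i (zeta L)).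
  have D0 y : (0 <= duality q k (zeta L) (single y))%R by exact: duality_ge0.
  apply: (@le_trans _ _ (c^-1%:E * ((h i (zeta L))^-1%:E *
      \esum_(y in [set: int]) (duality q k (zeta L) (single y) * p b y)%:E))); last first.
    rewrite lee_wpmul2l ?lee_fin ?invr_ge0 ?(ltW c0)// lee_wpmul2l ?lee_fin ?invr_ge0 ?(ltW hi0)//.
    by apply: asip_single_expectation_ge => y; exact: duality_ge0.
  have Dp0 y : 0 <= (duality q k (zeta L) (single y) * p b y)%:E by rewrite lee_fin mulr_ge0.
  have hV : (0 <= (h i (zeta L))^-1)%R by rewrite invr_ge0 ltW.
  have cV : (0 <= c^-1)%R by rewrite invr_ge0 ltW.
  rewrite -(ge0_esumZl _ hV Dp0) -(ge0_esumZl _ cV); last by move=> y; exact: mule_ge0.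
  rewrite setTI [leLHS]esum_mkcond; apply: le_esum => y _.
  rewrite mem_box -!EFinM duality_single//.
  have E : (q `^ (- (4 * k * y%:~R)) * p b y = q `^ (- (4 * k * b%:~R)) * p y b)%R.
    rewrite !powRN.
    have := transition_reversible hq0 hq1 hk hm t0 b y.
    move: (powR_gt0 (4 * k * y%:~R) hq0) (powR_gt0 (4 * k * b%:~R) hq0).
    move: (q `^ (4 * k * y%:~R))%R (q `^ (4 * k * b%:~R))%R => u v u0 v0 uv.
    have u1 : (u != 0)%R by rewrite gt_eqF.
    have v1 : (v != 0)%R by rewrite gt_eqF.
    by rewrite -(mulKf v1 (p b y)) uv; field; rewrite u1 v1.
  have -> : (c^-1 * ((h i (zeta L))^-1 * (q / (1 - q `^ (4 * k)) *
      (q `^ (- (4 * k * y%:~R)) * (h (y + 1) (zeta L) - h y (zeta L))) * p b y)))%R =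
      ((h (y + 1) (zeta L) - h y (zeta L)) / h i (zeta L) * p y b)%R.
    transitivity (c^-1 * (q / (1 - q `^ (4 * k)) * (q `^ (- (4 * k * y%:~R)) * p b y)) *
      ((h (y + 1) (zeta L) - h y (zeta L)) / h i (zeta L)))%R; first by ring.
    by rewrite E mulrA -/c mulKf ?gt_eqF// mulrC.
  by rewrite (height_trunc hq0)//; case: ifP => // _; rewrite mul0r.
have cv := esum_box_cvg (D := setT) inc0.
apply: (@le_lt_trans _ _ (c^-1%:E * l%:E)); last by rewrite -EFinM ltry.
apply: (lee_cvg_to cv _ a_ge).
by apply: cvgeZl.
Unshelve. all: by end_near. Qed.

(** The ratio is [q] to twice the mass in [[- L, i)]; it tends to 0 when that mass diverges, in
    accordance with the convention. *)
Lemma left_mass_cvg :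
  (h (- L%:Z) (zeta L) / h i (zeta L))%:E @[L --> \oo] --> (left_mass_term q eta i)%:E.
Proof.
pose s (L : nat) : R := ((N (- L%:Z) (zeta L))%:R - (N i (zeta L))%:R)%R.
have sE : \forall L \near \oo, (s L)%:E =
    \esum_(x in [set x : int | (x < i)%R] `&` box L) ((eta x)%:R : R)%:E.
  near=> L.
  pose g (x : int) : R := (- (N x (zeta L))%:R)%R.
  have gE x : (g (x + 1) - g x = (zeta L x)%:R)%R.
    by rewrite /g [N x _]N_recl natrD; ring.
  have := @esum_lt_telescope R i (- L%:Z)%R g.
  rewrite (_ : (g i - g (- L%:Z))%R = s L); last by rewrite /g /s; ring.
  move=> <-; first last.
  - by move=> x; rewrite -subr_ge0 gE.
  - move=> x xL; apply/eqP; rewrite -subr_eq0 gE trunc_config_out//; lia.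
  rewrite esum_mkcondr; apply: eq_esum => x _.
  by rewrite gE mem_box trunc_configE; case: ifP.
have scv : (s L)%:E @[L --> \oo] -->
    \esum_(x in [set x : int | (x < i)%R]) ((eta x)%:R : R)%:E.
  have a0 (x : int) : 0 <= ((eta x)%:R : R)%:E by rewrite lee_fin.
  apply: (cvg_trans _ (esum_box_cvg (D := [set x : int | (x < i)%R]) a0)).
  by apply: near_eq_cvg; apply: filterS sE => L ->.
(* As [- (2 * ln q)] is positive, this form serves both cases: continuity for finite mass, decay of
   the exponential for infinite mass. *)
have hE L : (h (- L%:Z) (zeta L) / h i (zeta L))%R = expR (- (- (2 * ln q) * s L)).
  rewrite /height -powRN -powRDq// /powR gt_eqF//; congr expR.
  by rewrite /s; ring.
under eq_fun do rewrite hE.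
rewrite /left_mass_term; move: scv.
have : 0 <= \esum_(x in [set x : int | (x < i)%R]) ((eta x)%:R : R)%:E.
  by apply: esum_ge0 => x _; rewrite lee_fin.
case: (esum _ _) => [u _|_|//] scv.
- have su : s L @[L --> \oo] --> u by exact: (fine_cvg scv).
  apply: cvg_EFin; first exact: nearW.
  rewrite (_ : q `^ (2 * u) = expR (- (- (2 * ln q) * u)))%R; last first.
    by rewrite /powR gt_eqF//; congr expR; ring.
  apply: continuous_cvg; first exact: continuous_expR.
  by apply: cvgN; apply: cvgMr.
- move/cvgeryP: scv => scv; apply: cvg_EFin; first exact: nearW.
  have lq : (0 < - (2 * ln q))%R by rewrite oppr_gt0 pmulr_rlt0// ln_lt0// hq0.
  have lqy : (- (2 * ln q) * x)%R @[x --> +oo%R] --> +oo%R.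
    by apply: gt0_cvgMry => //; exact: cvg_id.
  exact: (cvg_comp _ _ scv (cvg_comp _ _ lqy (@cvgr_expR R))).
Unshelve. all: by end_near. Qed.

(* Below [i] the increments telescope to at most [1]; from [i] on, the tail
   probability is comparable to that of sitting at [i - 1], where goodness applies. *)
Lemma tail_increment_sum_fin : good q k P X eta ->
  \esum_(x in [set: int]) (increment q eta i x * tailp x)%:E < +oo.
Proof.
move=> /good_increment_sum fin.
have p0 x y : (0 <= p x y)%R := transition_ge0 hm t0 x y.
have inc0 x : (0 <= increment q eta i x)%R by exact: increment_ge0.
pose c := expR (rate_total q k * t).
apply: (@le_lt_trans _ _ (\esum_(x in [set: int])
   ((if (x < i)%R then (increment q eta i x)%:E else 0) +
    c%:E * (increment q eta i x * p x (i - 1)%R)%:E))).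
  apply: le_esum => x _; have /andP[r0 r1] := tail_prob_bounds hm i t0 x.
  case: ltP => xi.
    rewrite -EFinM -EFinD lee_fin -[leLHS]addr0 lerD ?ler_piMr//.
    by rewrite mulr_ge0 ?expR_ge0// mulr_ge0.
  rewrite add0e -EFinM lee_fin mulrCA ler_wpM2l//.
  by apply: (walk_tail_le hq0 hq1 hk hm t0); lia.
rewrite esumD; first last.
- by move=> x _; rewrite mule_ge0 ?lee_fin ?expR_ge0// mulr_ge0.
- by move=> x _; case: ifP => // _; rewrite lee_fin.
rewrite ge0_esumZl ?expR_ge0//; last by move=> x; rewrite lee_fin mulr_ge0.
apply: lte_add_pinfty.
  apply: (@le_lt_trans _ _ 1); last exact: ltry.
  have H := increment_below_le1 hq0 hq1 eta i; apply: (le_trans _ H).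
  rewrite [leRHS]esum_mkcond; apply: le_esum => x _.
  by rewrite mem_below.
by apply: lte_mul_pinfty; rewrite ?lee_fin ?expR_ge0.
Qed.

End InfiniteVolume.

Theorem proposition6p2 (R : realType) (q k : R)
    (hq0 : 0 < q) (hq1 : q < 1) (hk : 0 < k)
    (d : measure_display) (Omega : measurableType d)
    (P : config -> probability Omega R) (X : R -> Omega -> config)
    (hX : is_markov_chain (asip_generator q k) P X)
    (d' : measure_display) (Omega' : measurableType d')
    (Pw : int -> probability Omega' R) (m : R -> Omega' -> int)
    (hm : is_markov_chain (walk_generator q k) Pw m)
    (eta : int -> nat) (heta : good q k P X eta)
    (i : int) (t : R) (ht : 0 <= t) :
  let rhs : \bar R :=
    ((left_mass_term q eta i)%:E -
     \sum_(0 <= j <oo)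
       let n := (i - 1 - j%:Z)%R in
       (q `^ (4 * k * n%:~R))%:E *
       'E_(Pw n)[fun w => (q `^ (- (4 * k * (m t w)%:~R)) *
                  (1 - q `^ (- (2 * (eta (m t w))%:R))) *
                  q `^ (2 * (Ndiff eta (m t w) i)%:~R))%R])%E in
  rhs \is a fin_num /\
  'E_(P (trunc_config eta L))[fun w =>
     (q `^ (2 * (current (trunc_config eta L) (X t w) i)%:~R))%R]%E
    @[L --> \oo] --> rhs.
Proof.
pose S := (\esum_(x in [set: int]) (increment q eta i x * tail_prob Pw m t i x)%:E)%E.
have r0 x : 0 <= tail_prob Pw m t i x by case/andP: (tail_prob_bounds hm i ht x).
have inc0 x : 0 <= increment q eta i x := increment_ge0 hq0 hq1 eta i x.
have S0 : (0 <= S)%E by apply: esum_ge0 => x _; rewrite lee_fin mulr_ge0.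
have S_fin : S \is a fin_num.
  rewrite ge0_fin_numE//.
  exact: (tail_increment_sum_fin hq0 hq1 hk hX hm i ht heta).
move=> rhs; have rhsE : rhs = ((left_mass_term q eta i)%:E + S)%E.
  pose u (j : nat) := ((q `^ (4 * k * (i - 1 - j%:Z)%:~R))%:E *
    \int[Pw (i - 1 - j%:Z)%R]_w (q `^ (- (4 * k * (m t w)%:~R)) *
      increment q eta i (m t w))%:E)%E.
  have uS : (\sum_(0 <= j <oo) u j)%E = S := reversed_walk_sum hq0 hq1 hk hm i ht inc0.
  have u0 j : (0 <= u j)%E.
    rewrite mule_ge0 ?lee_fin ?powR_ge0//; apply: integral_ge0 => w _.
    by rewrite lee_fin mulr_ge0 ?powR_ge0.
  (* The series in the statement has nonpositive terms, so it is matched with minus the series of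
     [u], sign by sign: in the limit, in the partial sums and in the integrals. *)
  rewrite /rhs -uS; congr (_ + _)%E; rewrite -[RHS]oppeK; congr (- _)%E.
  rewrite -limeN; last exact: is_cvg_nneseries.
  apply: congr_lim; apply/funext => J /=.
  rewrite -sumeN; last by move=> a b _ _; apply: ge0_adde_def; rewrite inE.
  apply: eq_bigr => j _; rewrite /u -muleN -integral_ge0N; last first.
    by move=> w _; rewrite lee_fin mulr_ge0 ?powR_ge0.
  rewrite unlock; congr (_ * _)%E; apply: eq_integral => w _.
  by rewrite -EFinN /increment; congr EFin; ring.
rewrite rhsE; split; first by rewrite fin_numD S_fin.
have cv : ((height q (- L%:Z) (trunc_config eta L) / height q i (trunc_config eta L))%:E +
    \esum_(x in setT `&` box L) (increment q eta i x * tail_prob Pw m t i x)%:E)%E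
    @[L --> \oo] --> ((left_mass_term q eta i)%:E + S)%E.
  apply: cvgeD; first by rewrite fin_num_adde_defr.
  - exact: left_mass_cvg.
  - by apply: esum_box_cvg => x; rewrite lee_fin mulr_ge0.
apply: (cvg_trans _ cv); apply: near_eq_cvg; near=> L.
rewrite setTI (trunc_current_moment hq0 hq1 hk hX hm)//.
by near: L; exact: nbhs_infty_box.
Unshelve. all: by end_near. Qed.
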